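(* Let $n\in\mathbb{N}$, $n\ge 1$. For $i=1,\ldots,n$ let $T_i$ be a contraction on a complex Hilbert space $\mathbb{H}_i$ with $\mathbb{T}\subseteq\sigma(T_i)$. Define linear maps $f_{\boldsymbol{T}},g_{\boldsymbol{T}}:\ell^1(n)\to\mathcal{B}(\mathbb{H}_1\otimes\cdots\otimes\mathbb{H}_n)$ by $$f_{\boldsymbol{T}}(a_1,\ldots,a_n)=\sum_{i=1}^n a_i\, I_{\mathbb{H}_1}\otimes\cdots\otimes I_{\mathbb{H}_{i-1}}\otimes T_i\otimes I_{\mathbb{H}_{i+1}}\otimes\cdots\otimes I_{\mathbb{H}_n},$$ $$g_{\boldsymbol{T}}(a_1,\ldots,a_n)=\sum_{i=1}^n a_i\, T_1\otimes\cdots\otimes T_i\otimes I_{\mathbb{H}_{i+1}}\otimes\cdots\otimes I_{\mathbb{H}_n};$$ both of these maps are isometries. Then the operator space structure on $\ell^1(n)$ induced by $f_{\boldsymbol{T}}$ is completely isometric to $\mathrm{MIN}(\ell^1(n))$, and likewise the operator space structure on $\ell^1(n)$ induced by $g_{\boldsymbol{T}}$ is completely isometric to $\mathrm{MIN}(\ell^1(n))$.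
   Context: $\ell^1(n)$ denotes $\mathbb{C}^n$ with the norm $\|(a_1,\ldots,a_n)\|_1=\sum_{i=1}^n|a_i|$. $\mathbb{T}$ is the unit circle in $\mathbb{C}$; $\sigma(T)$ is the spectrum of $T$; a contraction is a bounded linear operator of norm at most $1$; $\otimes$ of Hilbert spaces is the Hilbert space tensor product. $M_k(V)$ is the space of $k\times k$ matrices with entries in $V$, and $M_k=M_k(\mathbb{C})$ carries the operator norm. Induced operator space structure: if $V$ is a normed linear space and $\phi:V\to\mathcal{B}(\mathbb{H})$ is a linear isometry, the operator space structure on $V$ induced by $\phi$ is the sequence of norms $\|(v_{ij})\|_k=\|(\phi(v_{ij}))\|$ on $M_k(V)$, $k\ge1$, where $(\phi(v_{ij}))$ is regarded as an operator on $\mathbb{H}\oplus\cdots\oplus\mathbb{H}$ ($k$ copies). $\mathrm{MIN}(V)$ is $V$ with the norms $\|(v_{ij})\|_{\mathrm{MIN}}=\sup\{\|(f(v_{ij}))\|_{M_k}: f\in (V^* )_1\}$ on $M_k(V)$, $k\ge1$, where $(V^* )_1$ is the closed unit ball of the dual space $V^*$. Two operator spaces $(V,\|\cdot\|_k)$ and $(W,\|\cdot\|_k)$ are completely isometric if there is a linear bijection $T:V\to W$ such that for every $k\ge 1$ the entrywise map $T\otimes I_k:M_k(V)\to M_k(W)$, $(v_{ij})\mapsto(Tv_{ij})$, is an isometry. *)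

(* Defs.v *)
From HB Require Import structures.
From mathcomp Require Import all_boot all_order all_algebra.
From mathcomp Require Import complex.
From mathcomp Require Import all_classical all_reals all_analysis.

Set Warnings "-redundant-canonical-projection,-projection-no-head-constant".

Set Implicit Arguments.
Unset Strict Implicit.
Unset Printing Implicit Defensive.

Import Order.TTheory GRing.Theory Num.Theory.
Import numFieldNormedType.Exports.

Local Open Scope classical_set_scope.
Local Open Scope ring_scope.

(* In a normed module over R[i] the norm is R[i]-valued (and real); rnorm is
   the same norm with values in R. *)
Definition rnorm (R : realType) (V : normedZmodType R[i]) (x : V) : R :=
  complex.Re `|x|.

(* Complex Hilbert spaces. The inner product is linear in its first argument
   and conjugate-linear in the second one. *)
HB.mixin Record CompleteNormedModule_isHilbert (R : realType) H
    & CompleteNormedModule R[i] H := {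
  hdot : {dot H for @Num.conj R[i]} ;
  sqr_hnormE : forall x : H, `|x| ^+ 2 = hdot x x
}.

#[short(type="hilbertType")]
HB.structure Definition Hilbert (R : realType) :=
  { H of CompleteNormedModule_isHilbert R H & CompleteNormedModule R[i] H }.

Section BoundedOperators.
Context {R : realType}.

Section Def.
Variable H : hilbertType R.

Definition bounded_op : pred (H -> H) :=
  fun f => `[< linear f /\ continuous f >].

Lemma bounded_op_submod_closed : submod_closed bounded_op.
Proof.
split.
  apply/asboolP; split; first by move=> a x y; rewrite scaler0 addr0.
  by move=> x; exact: cvg_cst.
move=> a f g /asboolP[fl fc] /asboolP[gl gc]; apply/asboolP; split.
  move=> b x y; rewrite !fctE fl gl !scalerDr !scalerA (mulrC a b).
  by rewrite addrACA.
move=> x; apply: cvgD; last exact: gc.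
by apply: cvgZl_tmp; exact: fc.
Qed.

HB.instance Definition _ :=
  GRing.isSubmodClosed.Build R[i] (H -> H) bounded_op bounded_op_submod_closed.

(* The vector space B(H) of bounded linear operators on H. *)
Record bop := Bop { bop_fun :> H -> H ; bop_subproof : bop_fun \in bounded_op }.

HB.instance Definition _ := [isSub for bop_fun].
HB.instance Definition _ := [Choice of bop by <:].
HB.instance Definition _ := [SubChoice_isSubLmodule of bop by <:].

Lemma idop_subproof : (fun x : H => x) \in bounded_op.
Proof. by apply/asboolP; split=> // x; exact: cvg_id. Qed.

Definition idop : bop := Bop idop_subproof.

Definition spectrum (T : bop) : set R[i] :=
  [set z | ~ exists S : bop,
     (forall x, S (T x - z *: x) = x) /\ (forall x, T (S x) - z *: S x = x)].

End Def.
End BoundedOperators.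

Definition opnorm (R : realType) (V W : normedZmodType R[i]) (f : V -> W)
    : \bar R :=
  ereal_sup [set (rnorm (f x))%:E | x in [set x : V | rnorm x <= 1]].

Definition contractive (R : realType) (H : hilbertType R) (T : bop H) : Prop :=
  (opnorm T <= 1)%E.

(* The norm of the orthogonal direct sum of k copies of V. *)
Definition l2norm (R : realType) (V : normedZmodType R[i]) k (x : 'cV[V]_k) : R :=
  Num.sqrt (\sum_(i < k) rnorm (x i 0) ^+ 2).

(* The norm of M_k(C) acting on C^k. *)
Definition mx_opnorm (R : realType) k (A : 'M[R[i]]_k) : \bar R :=
  ereal_sup [set (l2norm (A *m x))%:E | x in [set x : 'cV_k | l2norm x <= 1]].

(* The norm of a k x k matrix of operators acting on the direct sum of k
   copies of H. *)
Definition bopmx_norm (R : realType) (H : hilbertType R) k (A : 'M[bop H]_k)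
    : \bar R :=
  ereal_sup [set (l2norm (\col_i \sum_j A i j (x j 0)))%:E
            | x in [set x : 'cV[H]_k | l2norm x <= 1]].

(* Sequences of matrix norms; only the values at k >= 1 are meaningful. *)
Definition matrix_norms (R : realType) (V : Type) := forall k, 'M[V]_k -> \bar R.

Definition linear_isometry (R : realType) (V : normedModType R[i])
    (H : hilbertType R) (phi : V -> bop H) : Prop :=
  linear phi /\ forall v, opnorm (phi v) = (rnorm v)%:E.

Definition induced_norms (R : realType) (V : normedModType R[i]) (H : hilbertType R)
    (phi : V -> bop H) : matrix_norms R V :=
  fun k v => bopmx_norm (map_mx phi v).
Arguments induced_norms {R V H} phi k v.

Definition dual_ball (R : realType) (V : normedModType R[i]) : set {scalar V} :=
  [set f | (opnorm (f : V -> R[i]) <= 1)%E].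

Definition MIN (R : realType) (V : normedModType R[i]) : matrix_norms R V :=
  fun k v => ereal_sup [set mx_opnorm (map_mx f v) | f in @dual_ball R V].
Arguments MIN {R} V k v.

Definition completely_isometric (R : realType) (V W : lmodType R[i])
    (nV : matrix_norms R V) (nW : matrix_norms R W) : Prop :=
  exists2 T : {linear V -> W}, bijective T &
    forall k, (0 < k)%N -> forall v : 'M[V]_k, nW k (map_mx T v) = nV k v.

(* C^n with the norm of l^1(n); row vectors themselves carry the sup norm. *)
Definition l1 (R : realType) (n : nat) : Type := 'rV[R[i]]_n.

Section L1.
Variables (R : realType) (n : nat).

HB.instance Definition _ := GRing.Lmodule.on (l1 R n).

Definition l1coord (a : l1 R n) (i : 'I_n) : R[i] := (a : 'rV_n) 0 i.

Definition l1norm (a : l1 R n) : R[i] := \sum_(i < n) `|l1coord a i|.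

Lemma ler_l1normD a b : l1norm (a + b) <= l1norm a + l1norm b.
Proof.
rewrite /l1norm -big_split; apply: ler_sum => i _.
by rewrite /l1coord mxE ler_normD.
Qed.

Lemma l1normZ (z : R[i]) a : l1norm (z *: a) = `|z| * l1norm a.
Proof.
by rewrite /l1norm mulr_sumr; apply: eq_bigr => i _; rewrite /l1coord mxE normrM.
Qed.

Lemma l1norm0_eq0 a : l1norm a = 0 -> a = 0.
Proof.
move=> a0; apply/rowP => i; rewrite mxE; apply/eqP; rewrite -normr_eq0.
by move/eqP: a0; rewrite psumr_eq0// => /allP/(_ i); rewrite mem_index_enum => /(_ isT).
Qed.

HB.instance Definition _ :=
  Lmodule_isNormed.Build R[i] (l1 R n) ler_l1normD l1normZ l1norm0_eq0.

End L1.

(* (K, tau) is a Hilbert space tensor product of the H_i, tau x being the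
   elementary tensor x_0 (x) ... (x) x_(n-1). This determines (K, tau) up to a
   unique unitary. *)
Record hilbert_tensor (R : realType) (n : nat) (H : 'I_n -> hilbertType R)
    (K : hilbertType R) (tau : (forall i, H i) -> K) : Prop := HilbertTensor {
  tensor_linear : forall (x : forall i, H i) (i : 'I_n),
    linear (fun u : H i => tau (eqtype.dfwith x u)) ;
  tensor_dot : forall x y : forall i, H i,
    hdot (tau x) (tau y) = \prod_(i < n) hdot (x i) (y i) ;
  tensor_dense : closure [set y : K | exists m (c : 'I_m -> R[i])
      (x : 'I_m -> forall i, H i), y = \sum_(j < m) c j *: tau (x j)] = setT
}.

Section TensorOperators.
Variables (R : realType) (n : nat) (H : 'I_n -> hilbertType R).
Variables (K : hilbertType R) (tau : (forall i, H i) -> K).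

(* S_0 (x) ... (x) S_(n-1): the bounded operator on K, unique when (K, tau) is
   a tensor product, that maps tau x to tau (S_0 x_0, ..., S_(n-1) x_(n-1)). *)
Definition tensor_op (S : forall i, bop (H i)) : bop K :=
  xget 0 [set A : bop K | forall x, A (tau x) = tau (fun i => S i (x i))].

Variable T : forall i, bop (H i).

Definition f_map (a : l1 R n) : bop K :=
  \sum_(i < n) l1coord a i *:
    tensor_op (fun j => if j == i then T j else idop (H j)).

Definition g_map (a : l1 R n) : bop K :=
  \sum_(i < n) l1coord a i *:
    tensor_op (fun j => if (j <= i)%N then T j else idop (H j)).

End TensorOperators.

(* Main.v *)
Require Import Defs.
From HB Require Import structures.
From mathcomp Require Import all_boot all_order all_algebra.
From mathcomp Require Import cyclic separable cyclotomic complex.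
From mathcomp Require Import all_classical all_reals all_analysis.
From mathcomp Require Import ring lra.

Set Implicit Arguments.
Unset Strict Implicit.
Unset Printing Implicit Defensive.

Import Order.TTheory GRing.Theory Num.Theory.
Import numFieldNormedType.Exports.

Local Open Scope classical_set_scope.
Local Open Scope ring_scope.
Local Open Scope complex_scope.

(** Both maps have the form [a |-> \sum_i a_i S_i] with
    [S_i = \bigotimes_j (if J i j then T_j else 1)]: [J i = {i}] for [f_map] and
    [J i = {0, .., i}] for [g_map]. For [z] in the torus let [z^J] be the vector
    of the products [\prod_(j in J i) z_j]; in both cases [z |-> z^J] maps the
    torus onto itself ([singleton_onto], [segment_onto]), and the argument rests on
    this. Write [A_i] for the matrix of the [i]-th coordinates of
    [v : 'M(l1 n)], so that the induced norm of [v] is that of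
    [\sum_i A_i (x) S_i], and its MIN norm is the supremum of the norms of
    [\sum_i w_i A_i] over [|w_i| <= 1].

    MIN is at most the induced norm ([MIN_le_induced]). The spectrum of [T_j] lies
    in the unit disc and contains its boundary, whose points are therefore
    approximate eigenvalues ([approximate_eigenvector]), and unit vectors [x_j] exist with [<T_j x_j, x_j>]
    arbitrarily close to a prescribed [z_j]. Compressing [\sum_i A_i (x) S_i] to
    [C^k (x) (x_0 (x) .. (x) x_(n-1))] gives almost [\sum_i w_i A_i] for any
    prescribed unimodular [w] ([weights_approximated]); choosing the phases [w_i]
    well, one bounds even [\sum_i |<A_i c, d>|], which dominates
    [|<\sum_i w_i A_i c, d>|] for all [|w_i| <= 1].

    The induced norm is at most MIN ([induced_le_MIN]). This is a von Neumann
    inequality with matrix coefficients, where positive kernels do the work of a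
    unitary dilation. For a contraction [T] the Fejer means of the Fourier series
    with coefficients the powers of [T] and of its adjoint are positive ([fejer_ge]).
    Sampling them at the roots of unity [w_s] gives positive kernels
    [p_s(x, y)] with [\sum_s p_s(x, y) = <x, y>] and
    [\sum_s w_s p_s(x, y) = N/(N+1) <T x, y>] ([sum_fejer_kernel],
    [sum_wfejer_kernel]). On elementary tensors, where inner products are products
    over the factors, multiplying out these sums writes the form
    of [\sum_i (N/(N+1))^#|J i| A_i (x) S_i] as a sum, over the samples [z] of the
    torus, of the forms of [\sum_i z^J_i A_i] weighted by entrywise products of
    positive kernels. Such products are positive, and a positive kernel is a Gram
    kernel ([psd_gram]), so each term inherits the scalar bound ([gram_bound]).
    Let [N] tend to infinity and use the density of the algebraic tensor product. *)

(** * Real-valued norms *)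

Section RealNorm.
Variables (R : realType) (V : normedZmodType R[i]).
Implicit Types x y : V.

Lemma normE x : `|x| = (rnorm x)%:C.
Proof. by rewrite /rnorm RRe_real// normr_real. Qed.

Lemma rnorm_ge0 x : 0 <= rnorm x.
Proof. by rewrite -ler0c -normE. Qed.

Lemma ler_rnormD x y : rnorm (x + y) <= rnorm x + rnorm y.
Proof. by rewrite -lecR rmorphD/= -!normE ler_normD. Qed.

Lemma rdistrC x y : rnorm (x - y) = rnorm (y - x).
Proof. by rewrite /rnorm distrC. Qed.

Lemma ler_rdistD z x y : rnorm (x - y) <= rnorm (x - z) + rnorm (z - y).
Proof. by rewrite -[x - y](subrKA z) ler_rnormD. Qed.

Lemma rnorm0 : rnorm (0 : V) = 0.
Proof. by rewrite /rnorm normr0. Qed.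

Lemma rnorm_eq0 x : (rnorm x == 0) = (x == 0).
Proof. by rewrite -[x == 0]normr_eq0 normE -(inj_eq (@complexI R)). Qed.

Lemma rnorm_gt0 x : (0 < rnorm x) = (x != 0).
Proof. by rewrite lt_def rnorm_ge0 andbT rnorm_eq0. Qed.

Lemma ler_rnorm_sum (I : Type) (r : seq I) (P : pred I) (F : I -> V) :
  rnorm (\sum_(i <- r | P i) F i) <= \sum_(i <- r | P i) rnorm (F i).
Proof.
elim/big_rec2: _ => [|i y x _ h]; first by rewrite rnorm0.
by apply: le_trans (ler_rnormD _ _) _; rewrite lerD2l.
Qed.

End RealNorm.

Section RealNormC.
Variable R : realType.
Implicit Types z w : R[i].

Lemma rnormM z w : rnorm (z * w) = rnorm z * rnorm w.
Proof. by apply: complexI; rewrite rmorphM/= -!normE normrM. Qed.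

Lemma rnorm1 : rnorm (1 : R[i]) = 1.
Proof. by rewrite /rnorm normr1. Qed.

Lemma rnormX z m : rnorm (z ^+ m) = rnorm z ^+ m.
Proof. by elim: m => [|m IH]; rewrite ?expr0 ?rnorm1// !exprS rnormM IH. Qed.

Lemma rnormJ z : rnorm (conjc z) = rnorm z.
Proof. by rewrite /rnorm normcJ. Qed.

Lemma rnormR (x : R) : rnorm x%:C = `|x|.
Proof. by rewrite /rnorm normc_def/= expr0n/= addr0 sqrtr_sqr. Qed.

Lemma rnorm_prod (I : Type) (r : seq I) (P : pred I) (F : I -> R[i]) :
  rnorm (\prod_(i <- r | P i) F i) = \prod_(i <- r | P i) rnorm (F i).
Proof. by elim/big_rec2: _ => [|i y x _ <-]; rewrite ?rnorm1// rnormM. Qed.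

Lemma mulcJ z : z * conjc z = (rnorm z ^+ 2)%:C.
Proof. by rewrite -sqr_normc normE rmorphXn. Qed.

Lemma conjc_ger0 z : 0 <= z -> conjc z = z.
Proof. by move=> /ger0_real/CrealP. Qed.

Lemma unit_normP z : `|z| = 1 <-> rnorm z = 1.
Proof. by rewrite normE; split=> [/complexI|->]. Qed.

Lemma Re_le_rnorm z : complex.Re z <= rnorm z.
Proof. by rewrite -lecR -normE; apply: le_trans (normc_ge_Re z); rewrite lecR ler_norm. Qed.

Lemma rnormZ (V : normedModType R[i]) z (x : V) : rnorm (z *: x) = rnorm z * rnorm x.
Proof. by apply: complexI; rewrite rmorphM/= -!normE normrZ. Qed.

(** The phase of [z]; any unit scalar does at [z = 0]. *)
Lemma phase_exists z : exists2 w, rnorm w = 1 & z * w = (rnorm z)%:C.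
Proof.
have [->|z0] := eqVneq z 0; first by exists 1; rewrite ?rnorm1// mul0r rnorm0.
have nz : (rnorm z)%:C != 0 :> R[i].
  by rewrite -[0]/(0%:C) (inj_eq (@complexI R)) rnorm_eq0.
exists (conjc z / (rnorm z)%:C).
  by apply: (@mulIf _ (rnorm z)); rewrite ?rnorm_eq0// -{2}[rnorm z]ger0_norm ?rnorm_ge0//
    -rnormR -rnormM mulfVK// rnormJ mul1r.
by rewrite mulrA mulcJ rmorphXn/= expr2 mulfK.
Qed.

End RealNormC.

(** * Inner products *)

Section InnerProduct.
Variables (R : realType) (H : hilbertType R).
Implicit Types (x y z : H) (a : R[i]).

(** A plain function with values in [R[i]], so that rewriting never has to
    look through the structure carried by [hdot]. *)
Definition ip x y : R[i] := hdot x y.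

Lemma ipDl x y z : ip (x + y) z = ip x z + ip y z.
Proof. exact: linearDl. Qed.

Lemma ipDr x y z : ip z (x + y) = ip z x + ip z y.
Proof. exact: linearDr. Qed.

Lemma ipZl a x y : ip (a *: x) y = a * ip x y.
Proof. exact: linearZl_LR. Qed.

Lemma ipZr a x y : ip x (a *: y) = conjc a * ip x y.
Proof. exact: linearZr_LR. Qed.

Lemma ipC x y : ip x y = conjc (ip y x).
Proof. by rewrite /ip hermC expr0 mul1r. Qed.

Lemma ipBl x y z : ip (x - y) z = ip x z - ip y z.
Proof. exact: linearBl. Qed.

Lemma ipBr x y z : ip z (x - y) = ip z x - ip z y.
Proof. exact: linearBr. Qed.

Lemma ip0l x : ip 0 x = 0.
Proof. exact: linear0l. Qed.

Lemma ip_suml (I : Type) (r : seq I) (P : pred I) (F : I -> H) y :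
  ip (\sum_(i <- r | P i) F i) y = \sum_(i <- r | P i) ip (F i) y.
Proof. exact: linear_sumlz. Qed.

Lemma ip_sumr (I : Type) (r : seq I) (P : pred I) (F : I -> H) y :
  ip y (\sum_(i <- r | P i) F i) = \sum_(i <- r | P i) ip y (F i).
Proof. exact: linear_sumr. Qed.

Lemma ipxx x : ip x x = (rnorm x ^+ 2)%:C.
Proof. by rewrite /ip -sqr_hnormE normE rmorphXn. Qed.

Lemma ipxx_ge0 x : 0 <= ip x x.
Proof. by rewrite ipxx ler0c sqr_ge0. Qed.

Lemma sqr_rnormB x y :
  rnorm (x - y) ^+ 2 = rnorm x ^+ 2 + rnorm y ^+ 2 - 2 * complex.Re (ip x y).
Proof.
apply: complexI; rewrite -ipxx ipBl !ipBr !ipxx (ipC y x).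
rewrite rmorphB rmorphD (rmorphM _ 2) rmorph_nat -addcJ !rmorphXn/=.
by ring.
Qed.

(** Expand the square of the norm of [|y| x - |x| y]. *)
Lemma Re_ip_le x y : complex.Re (ip x y) <= rnorm x * rnorm y.
Proof.
have [->|x0] := eqVneq x 0; first by rewrite ip0l rnorm0 mul0r.
have [->|y0] := eqVneq y 0; first by rewrite ipC ip0l conjc0 rnorm0 mulr0.
have := sqr_ge0 (rnorm ((rnorm y)%:C *: x - (rnorm x)%:C *: y)).
rewrite sqr_rnormB !rnormZ !rnormR !ger0_norm ?rnorm_ge0//.
rewrite ipZl ipZr conjc_real mulrA -rmorphM/=.
case: (ip x y) => a b; simpc => /= h.
move: x0 y0; rewrite -!rnorm_gt0 => x0 y0.
rewrite -(ler_pM2l (mulr_gt0 x0 y0)); nra.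
Qed.

Lemma ip_le x y : rnorm (ip x y) <= rnorm x * rnorm y.
Proof.
have [w w1 hw] := phase_exists (ip x y).
have := Re_ip_le (w *: x) y.
by rewrite ipZl rnormZ mulrC hw w1 mul1r.
Qed.

End InnerProduct.

(** * Positive semidefinite kernels *)

Section Kernels.
Variables (R : realType) (I : finType).
Implicit Types P Q : I -> I -> R[i].

Definition psd P :=
  (forall j l, P l j = conjc (P j l)) /\
  (forall c : I -> R[i], 0 <= \sum_j \sum_l c j * conjc (c l) * P j l).

Definition gram P := exists (S : finType) (u : S -> I -> R[i]),
  forall j l, P j l = \sum_s u s j * conjc (u s l).

Lemma eq_gram P Q : P =2 Q -> gram P -> gram Q.
Proof. by move=> e [S [u h]]; exists S, u => j l; rewrite -e. Qed.

(** Diagonalize the matrix of the kernel in an orthonormal basis; its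
    eigenvalues are nonnegative and have square roots. *)
Lemma psd_gram P : psd P -> gram P.
Proof.
move=> [Pherm Ppos].
pose A : 'M[R[i]]_#|I| := \matrix_(a, b) P (enum_val a) (enum_val b).
have Aherm : A \is hermsymmx.
  apply/is_hermitianmxP; rewrite expr0 scale1r; apply/matrixP => a b.
  by rewrite !mxE Pherm.
have /orthomx_spectralP := hermitian_normalmx Aherm.
have Uunit := spectral_unitarymx A.
rewrite invmx_unitary//.
move: Uunit; set U := spectralmx A; set D := spectral_diag A => Uunit AE.
have DE : diag_mx D = U *m A *m (map_mx conjc U^T).
  have UU := unitarymxP Uunit.
  by rewrite AE !mulmxA UU mul1mx -mulmxA UU mulmx1.
have Dpos s : 0 <= D 0 s.
  have -> : D 0 s = diag_mx D s s by rewrite mxE eqxx.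
  rewrite DE; have := Ppos (fun j => U s (enum_rank j)).
  congr (0 <= _); rewrite mxE.
  under [RHS]eq_bigr do rewrite !mxE mulr_suml.
  rewrite exchange_big/=.
  rewrite (reindex (@enum_val I predT)); last exact/onW_bij/enum_val_bij.
  apply: eq_bigr => a _.
  rewrite (reindex (@enum_val I predT)); last exact/onW_bij/enum_val_bij.
  by apply: eq_bigr => b _; rewrite !enum_valK !mxE mulrAC.
exists 'I_#|I|, (fun s j => sqrtC (D 0 s) * conjc (U s (enum_rank j))) => j l.
have -> : P j l = A (enum_rank j) (enum_rank l) by rewrite mxE !enum_rankK.
rewrite AE mxE; apply: eq_bigr => s _.
rewrite mul_mx_diag !mxE rmorphM/= conjcK.
rewrite (conjc_ger0 (z := sqrtC _)) ?sqrtC_ge0//.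
by rewrite mulrACA -expr2 sqrtCK mulrA (mulrC (D 0 s)).
Qed.

Lemma gram_sum_ge0 P (c : I -> R[i]) : gram P ->
  0 <= \sum_j \sum_l c j * conjc (c l) * P j l.
Proof.
move=> [S [u PE]].
have -> : \sum_j \sum_l c j * conjc (c l) * P j l =
    \sum_s `|\sum_j c j * u s j| ^+ 2.
  under eq_bigr do under eq_bigr do rewrite PE mulr_sumr.
  under eq_bigr do rewrite exchange_big/=.
  rewrite exchange_big; apply: eq_bigr => s _.
  rewrite sqr_normc rmorph_sum/= mulr_suml; apply: eq_bigr => j _.
  by rewrite mulr_sumr; apply: eq_bigr => l _; rewrite rmorphM/= mulrACA.
by apply: sumr_ge0 => s _; rewrite exprn_ge0.
Qed.

Lemma gram1 : gram (fun _ _ => 1).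
Proof.
exists unit, (fun _ _ => 1) => j l.
by rewrite (big_pred1 tt) ?conjc1 ?mulr1// => -[].
Qed.

Lemma gram0 : gram (fun _ _ => 0).
Proof. by exists void, (fun _ _ => 1) => j l; rewrite big_pred0// => -[]. Qed.

Lemma gramM P Q : gram P -> gram Q -> gram (fun j l => P j l * Q j l).
Proof.
move=> [S [u uE]] [S' [v vE]].
exists (S * S')%type, (fun p j => u p.1 j * v p.2 j) => j l.
rewrite uE vE mulr_suml -(pair_bigA _ (fun s t =>
  u s j * v t j * conjc (u s l * v t l)))/=.
apply: eq_bigr => s _; rewrite mulr_sumr; apply: eq_bigr => t _.
by rewrite rmorphM mulrACA.
Qed.

Lemma gramD P Q : gram P -> gram Q -> gram (fun j l => P j l + Q j l).
Proof.
move=> [S [u uE]] [S' [v vE]].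
exists (S + S')%type, (fun p => match p with inl s => u s | inr t => v t end) => j l.
by rewrite uE vE big_sumType.
Qed.

Lemma gram_prod (J : Type) (r : seq J) (F : J -> I -> I -> R[i]) :
  (forall t, gram (F t)) -> gram (fun j l => \prod_(t <- r) F t j l).
Proof.
move=> h; elim: r => [|t r IH].
  by apply: eq_gram gram1 => j l; rewrite big_nil.
by apply: eq_gram (gramM (h t) IH) => j l; rewrite big_cons.
Qed.

(** Entrywise products are monotone for the order of kernels. *)
Lemma gram_prodB (J : Type) (r : seq J) (F G : J -> I -> I -> R[i]) :
  (forall t, gram (G t)) -> (forall t, gram (fun j l => F t j l - G t j l)) ->
  gram (fun j l => \prod_(t <- r) F t j l - \prod_(t <- r) G t j l).
Proof.
move=> hG hFG.
have hF t : gram (F t).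
  by apply: eq_gram (gramD (hG t) (hFG t)) => j l; rewrite addrC subrK.
elim: r => [|t r IH].
  by apply: eq_gram gram0 => j l; rewrite !big_nil subrr.
apply: eq_gram (gramD (gramM (hFG t) (gram_prod r hF)) (gramM (hG t) IH)) => j l.
by rewrite !big_cons; ring.
Qed.

End Kernels.

(** * Fejer kernels of a contraction *)

(** The [M]-th roots of unity stand in for Haar measure on the circle: summing
    over them is exact on trigonometric polynomials of degree less than [M]. *)
Lemma unity_quadrature (R : realType) (M : nat) : (0 < M)%N ->
  exists w : 'I_M -> R[i], (forall s, rnorm (w s) = 1) /\
    forall a b, (a < M)%N -> (b < M)%N ->
      \sum_s w s ^+ a * conjc (w s) ^+ b = if a == b then M%:R else 0.
Proof.
move=> M0.
have [z zP] : exists z : R[i], M.-primitive_root z.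
  have [r pE] := closed_field_poly_normal ('X^M - 1 : {poly R[i]}).
  move: pE; rewrite (monicP _) ?monicXnsubC// scale1r => pE.
  have rn1 : all M.-unity_root r.
    by apply/allP => z; rewrite -root_prod_XsubC -pE.
  have sr : (M < (size r).+1)%N.
    by rewrite -(size_prod_XsubC r id) -pE size_XnsubC.
  have [|z zr] := hasP (has_prim_root M0 rn1 _ sr); last by exists z.
  by rewrite -separable_prod_XsubC -pE separable_Xn_sub_1// pnatr_eq0 -lt0n.
have z1 : rnorm z = 1.
  apply/eqP; rewrite -(@pexpr_eq1 _ _ M) ?rnorm_ge0// -rnormX.
  by rewrite (prim_expr_order zP) rnorm1.
have zJ : z * conjc z = 1 by rewrite mulcJ z1 expr1n.
exists (fun s => z ^+ s); split => [s|a b aM bM].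
  by rewrite rnormX z1 expr1n.
pose q := z ^+ a * conjc z ^+ b.
have -> : \sum_(s < M) (z ^+ s) ^+ a * conjc (z ^+ s) ^+ b = \sum_(s < M) q ^+ s.
  apply: eq_bigr => s _; rewrite /q rmorphXn/= exprMn -!exprM.
  by rewrite (mulnC a) (mulnC b).
have [ab|ab] := eqVneq a b.
  rewrite /q ab -exprMn zJ expr1n.
  under eq_bigr do rewrite expr1n.
  by rewrite sumr_const card_ord.
have q1 : q - 1 != 0.
  rewrite subr_eq0; apply: contra ab => /eqP qE.
  have /eqP : z ^+ a = z ^+ b.
    have := congr1 (fun x => x * z ^+ b) qE; rewrite mul1r => <-.
    by rewrite /q -mulrA -exprMn (mulrC _ z) zJ expr1n mulr1.
  by rewrite (eq_prim_root_expr zP) !modn_small.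
apply: (mulfI q1); rewrite mulr0 -subrX1 /q exprMn -!exprM !(mulnC _ M) !exprM.
by rewrite -rmorphXn/= (prim_expr_order zP) conjc1 !expr1n mulr1 subrr.
Qed.

Section Fejer.
Variables (R : realType) (H : hilbertType R) (T : H -> H).
Hypotheses (Tlin : linear T) (Tcontr : forall x, rnorm (T x) <= rnorm x).
Implicit Types (x y : H) (w : R[i]).

HB.instance Definition _ := GRing.isLinear.Build R[i] H H *:%R T Tlin.

(** Both subtractions are truncated: this is [<T^(j-l) x, y>] for [l <= j] and
    [<x, T^(l-j) y>] for [j <= l], the entry [(j, l)] of the Toeplitz matrix of
    the powers of [T]. *)
Definition toeplitz (j l : nat) x y := ip (iter (j - l) T x) (iter (l - j) T y).

(** For [|w| = 1], [N] times the [N]-th Fejer mean at [conjc w] of the Fourier series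
    with [j]-th coefficient [<T^j x, y>] and [(-j)]-th coefficient [<x, T^j y>]. *)
Definition fejer w N x y : R[i] :=
  \sum_(j < N) \sum_(l < N) w ^+ l * conjc w ^+ j * toeplitz j l x y.

Definition weighted_orbit w N x : H := \sum_(l < N.+1) w ^+ l *: iter (N - l) T x.

Lemma weighted_orbitS w N x :
  weighted_orbit w N.+1 x = w ^+ N.+1 *: x + T (weighted_orbit w N x).
Proof.
rewrite /weighted_orbit big_ord_recr/= subnn addrC; congr (_ + _).
rewrite linear_sum; apply: eq_bigr => l _ /=.
by rewrite linearZ/= subSn// -ltnS.
Qed.

(** Bordering the Toeplitz matrix adds [|y|^2 - |T y'|^2] to the form, where [y']
    and [y] are consecutive weighted orbit sums; as [|T y'| <= |y'|], the
    differences telescope. *)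
Lemma fejer_ge w N x :
  ip (weighted_orbit w N x) (weighted_orbit w N x) <= fejer w N.+1 x x.
Proof.
elim: N => [|N IH].
  rewrite /weighted_orbit /fejer !big_ord_recl !big_ord0 !addr0 /toeplitz/=.
  by rewrite !expr0 !mul1r scale1r.
pose y := weighted_orbit w N x; pose h := w ^+ N.+1 *: x.
have -> : fejer w N.+2 x x =
    fejer w N.+1 x x + ip h (T y) + (ip (T y) h + ip h h).
  rewrite {1}/fejer big_ord_recr/=; congr (_ + _).
    under eq_bigr do rewrite big_ord_recr/=.
    rewrite big_split/=; congr (_ + _).
    rewrite /h /y /weighted_orbit ipZl linear_sum ip_sumr mulr_sumr.
    apply: eq_bigr => j _; rewrite /toeplitz linearZ/= ipZr rmorphXn/= mulrA.
    have jN : (j <= N)%N by rewrite -ltnS.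
    by rewrite subSn// (eqP (leqW jN : (j - N.+1 == 0)%N)).
  rewrite big_ord_recr/= /toeplitz subnn/= /h ipZr [in ip (T y) _]/y.
  rewrite /weighted_orbit linear_sum ip_suml mulr_sumr; congr (_ + _).
    apply: eq_bigr => l _; rewrite linearZ/= ipZl rmorphXn/= mulrA.
    have lN : (l <= N)%N by rewrite -ltnS.
    by rewrite subSn// (eqP (leqW lN : (l - N.+1 == 0)%N)) (mulrC (w ^+ l)).
  by rewrite ipZl ipZr rmorphXn/= mulrA.
rewrite weighted_orbitS -/y -/h ipDl !ipDr.
have Ty : ip (T y) (T y) <= ip y y.
  by rewrite !ipxx lecR ler_sqr ?nnegrE ?rnorm_ge0.
have -> : ip h h + ip h (T y) + (ip (T y) h + ip (T y) (T y)) =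
    ip (T y) (T y) + ip h (T y) + (ip (T y) h + ip h h) by ring.
by rewrite !lerD2r (le_trans Ty).
Qed.

Lemma fejer_ge0 w N x : 0 <= fejer w N x x.
Proof.
case: N => [|N]; first by rewrite /fejer big_ord0.
exact: le_trans (ipxx_ge0 _) (fejer_ge _ _ _).
Qed.

Lemma fejerC w N x y : fejer w N y x = conjc (fejer w N x y).
Proof.
rewrite /fejer rmorph_sum exchange_big/=; apply: eq_bigr => l _.
rewrite rmorph_sum; apply: eq_bigr => j _.
by rewrite !rmorphM !rmorphXn/= conjcK /toeplitz -ipC (mulrC (w ^+ _)).
Qed.

Lemma iter_sumZ (I : finType) (m : nat) (c : I -> R[i]) (X : I -> H) :
  iter m T (\sum_i c i *: X i) = \sum_i c i *: iter m T (X i).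
Proof.
elim: m => //= m ->; rewrite linear_sum; apply: eq_bigr => i _.
by rewrite linearZ.
Qed.

Lemma fejer_sesqui (I : finType) w N (c : I -> R[i]) (X : I -> H) :
  fejer w N (\sum_i c i *: X i) (\sum_i c i *: X i) =
  \sum_i \sum_k c i * conjc (c k) * fejer w N (X i) (X k).
Proof.
have toepE j l : toeplitz j l (\sum_i c i *: X i) (\sum_i c i *: X i) =
    \sum_i \sum_k c i * conjc (c k) * toeplitz j l (X i) (X k).
  rewrite /toeplitz !iter_sumZ ip_suml; apply: eq_bigr => i _.
  by rewrite ip_sumr; apply: eq_bigr => k _; rewrite ipZl ipZr mulrA.
rewrite /fejer.
under eq_bigr do under eq_bigr do rewrite toepE mulr_sumr.
under eq_bigr do rewrite exchange_big/=.
rewrite exchange_big; apply: eq_bigr => i _.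
under eq_bigr do under eq_bigr do rewrite mulr_sumr.
under eq_bigr do rewrite exchange_big/=.
rewrite exchange_big; apply: eq_bigr => k _.
rewrite mulr_sumr; apply: eq_bigr => j _.
by rewrite mulr_sumr; apply: eq_bigr => l _; rewrite mulrCA.
Qed.

Lemma fejer_gram (I : finType) w N (a : R[i]) (X : I -> H) : 0 <= a ->
  gram (fun j l => a * fejer w N (X j) (X l)).
Proof.
move=> a0; apply: psd_gram; split=> [j l|c].
  by rewrite rmorphM/= conjc_ger0// -fejerC.
have := mulr_ge0 a0 (fejer_ge0 w N (\sum_i c i *: X i)).
rewrite fejer_sesqui mulr_sumr; congr (0 <= _).
apply: eq_bigr => j _; rewrite mulr_sumr; apply: eq_bigr => l _.
by rewrite mulrCA.
Qed.

Section Quadrature.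
Variables (N : nat) (w : 'I_N.+2 -> R[i]).
Hypothesis wP : forall a b, (a < N.+2)%N -> (b < N.+2)%N ->
  \sum_s w s ^+ a * conjc (w s) ^+ b = if a == b then N.+2%:R else 0.

(** [N.+1] averages the Fejer mean, and [N.+2 > N.+1] sample points avoid aliasing
    between the coefficients [1] and [-N]. *)
Definition fejer_kernel s x y := (N.+2 * N.+1)%:R^-1 * fejer (w s) N.+1 x y.

Let nz : (N.+2 * N.+1)%:R != 0 :> R[i].
Proof. by rewrite pnatr_eq0. Qed.

Lemma sum_fejer_kernel x y : \sum_s fejer_kernel s x y = ip x y.
Proof.
rewrite -mulr_sumr; apply: (mulfI nz); rewrite mulVKf// exchange_big/=.
transitivity (\sum_(j < N.+1) N.+2%:R * ip x y); last first.
  by rewrite sumr_const card_ord -[_ *+ N.+1]mulr_natl mulrA -natrM mulnC.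
apply: eq_bigr => j _; rewrite exchange_big/=.
under eq_bigr => l _.
  rewrite -mulr_suml wP; [|exact/leqW/ltn_ord|exact/leqW/ltn_ord].
  over.
rewrite (bigD1 j)//= eqxx big1 ?addr0 /toeplitz ?subnn// => l lj.
by rewrite -[_ == _]/(l == j) (negPf lj) mul0r.
Qed.

(** The factor [N / N.+1] is the weight of the first coefficient in the Fejer
    mean. *)
Lemma sum_wfejer_kernel x y :
  \sum_s w s * fejer_kernel s x y = N%:R / N.+1%:R * ip (T x) y.
Proof.
rewrite /fejer_kernel; under eq_bigr do rewrite mulrCA.
rewrite -mulr_sumr; apply: (mulfI nz); rewrite mulVKf//.
under eq_bigr do rewrite mulr_sumr.
rewrite exchange_big/=.
transitivity (\sum_(j < N.+1) if j == 0%N :> nat then 0 else N.+2%:R * ip (T x) y).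
  apply: eq_bigr => j _.
  under eq_bigr do rewrite mulr_sumr.
  rewrite exchange_big/=.
  under eq_bigr => l _.
    under eq_bigr do rewrite !mulrA -exprS.
    rewrite -mulr_suml wP; [|by rewrite ltnS|exact/leqW/ltn_ord].
    over.
  case: j => -[|j] jN/=.
    by rewrite big1// => l _; rewrite mul0r.
  rewrite (bigD1 (Ordinal (ltnW jN)))//= eqxx big1 ?addr0 /toeplitz/=.
    by rewrite subSn// subnn (eqP (leqnSn j : (j - j.+1 == 0)%N)).
  by move=> l lj; rewrite eqSS -[_ == _]/(l == Ordinal (ltnW jN)) (negPf lj) mul0r.
rewrite big_ord_recl/= add0r sumr_const card_ord -[_ *+ N]mulr_natl natrM.
have nz1 : N.+1%:R != 0 :> R[i] by rewrite pnatr_eq0.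
by field.
Qed.

End Quadrature.
End Fejer.

(** * Suprema over unit balls *)

Section UnitBall.
Variables (R : realType) (E : Type) (sc : R -> E -> E) (p q : E -> R).
Hypotheses (q_ge0 : forall x, 0 <= q x).
Hypotheses (psc : forall (t : R) x, 0 <= t -> p (sc t x) = t * p x).
Hypotheses (qsc : forall (t : R) x, 0 <= t -> q (sc t x) = t * q x).

(** Homogeneity is all that relates a supremum over the unit ball to a bound at
    every point. The scaling [sc] is abstract, so as to cover columns of vectors
    of a Hilbert space. *)
Lemma ball_sup_leP (m : R) : 0 <= m ->
  (ereal_sup [set (p x)%:E | x in [set x | (q x <= 1)%R]] <= m%:E)%E <->
  forall x, p x <= m * q x.
Proof.
move=> m0; split=> [h x|h]; last first.
  apply: ge_ereal_sup => _ [x /= qx <-]; rewrite lee_fin.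
  by rewrite (le_trans (h x))// ler_piMr.
have hx t : 0 <= t -> t * q x <= 1 -> t * p x <= m.
  move=> t0 tq; rewrite -psc// -lee_fin; apply: le_trans h.
  by apply: ereal_sup_ubound; exists (sc t x) => //=; rewrite qsc.
have [q0|q0] := eqVneq (q x) 0.
  (* arbitrarily large multiples of [x] stay in the ball *)
  rewrite q0 mulr0 leNgt; apply/negP => p0.
  have /hx : 0 <= (m + 1) / p x by rewrite divr_ge0 ?addr_ge0// ltW.
  by rewrite q0 mulr0 ler01 divfK ?gt_eqF// => /(_ isT); rewrite leNgt ltrDl ltr01.
have qx : 0 < q x by rewrite lt_def q0 q_ge0.
rewrite mulrC -ler_pdivrMl// hx ?invr_ge0//.
by rewrite mulVf.
Qed.

End UnitBall.

Section Convergence.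
Variables (R : realType) (V : normedModType R[i]).

Lemma rcvgP (X : Type) (F : set_system X) {FF : Filter F} (f : X -> V) (y : V) :
  f @ F --> y <-> forall e : R, 0 < e -> \forall t \near F, rnorm (y - f t) < e.
Proof.
rewrite cvgrPdist_lt; split=> h e e0.
  have /h : 0 < e%:C by rewrite ltcR.
  by apply: filterS => t; rewrite normE ltcR.
have /h : 0 < complex.Re e by rewrite -ltcR RRe_real ?gtr0_real.
by apply: filterS => t; rewrite -ltcR RRe_real ?gtr0_real// -normE.
Qed.

End Convergence.

Section OperatorNorm.
Variable R : realType.

Lemma opnorm_leP (V : normedModType R[i]) (W : normedZmodType R[i]) (f : V -> W)
    (m : R) :
  (forall (t : R) x, 0 <= t -> rnorm (f (t%:C *: x)) = t * rnorm (f x)) -> 0 <= m ->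
  (opnorm f <= m%:E)%E <-> forall x, rnorm (f x) <= m * rnorm x.
Proof.
move=> fZ; apply: (ball_sup_leP (sc := fun t x => t%:C *: x)) => //.
  by move=> x; exact: rnorm_ge0.
by move=> t x t0; rewrite rnormZ rnormR ger0_norm.
Qed.

Section Bop.
Variable H : hilbertType R.

Lemma bop_linear (T : bop H) : linear T.
Proof. by case: T => f /= /asboolP[]. Qed.

Lemma bop_continuous (T : bop H) : continuous T.
Proof. by case: T => f /= /asboolP[]. Qed.

HB.instance Definition _ (T : bop H) :=
  GRing.isLinear.Build R[i] H H *:%R T (@bop_linear T).

Lemma bop_opnorm_leP (T : bop H) (m : R) : 0 <= m ->
  (opnorm T <= m%:E)%E <-> forall x, rnorm (T x) <= m * rnorm x.
Proof.
apply: opnorm_leP => t x t0.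
by rewrite linearZ rnormZ rnormR ger0_norm.
Qed.

Lemma contractiveP (T : bop H) :
  contractive T <-> forall x, rnorm (T x) <= rnorm x.
Proof.
rewrite /contractive (bop_opnorm_leP T ler01).
by split=> h x; have := h x; rewrite mul1r.
Qed.

Lemma bop_of_bounded (f : H -> H) (c : R) : linear f ->
  (forall x, rnorm (f x) <= c * rnorm x) -> exists S : bop H, S =1 f.
Proof.
move=> fl fc.
suff fb : f \in @bounded_op R H by exists (Bop fb).
apply/asboolP; split=> // x; apply/rcvgP => e e0; apply/nbhs_normP.
exists (e / (`|c| + 1))%:C => /=; first by rewrite ltcR divr_gt0// ltr_wpDl.
move=> y /=; rewrite normE ltcR ltr_pdivlMr ?ltr_wpDl// => xy.
have -> : f x - f y = f (x - y).
  by rewrite [x - y]addrC -[- y]scaleN1r fl scaleN1r addrC.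
apply: le_lt_trans (fc _) (le_lt_trans _ xy).
by rewrite mulrC ler_wpM2l ?rnorm_ge0// (le_trans (ler_norm c))// lerDl.
Qed.

End Bop.
End OperatorNorm.

(** * Approximate eigenvectors at the points of the unit circle *)

Section FixedPoint.
Variables (R : realType) (V : completeNormedModType R[i]).

Lemma cauchy_seq_cvg (u : nat -> V) :
  (forall e : R, 0 < e -> exists N, forall k, rnorm (u (N + k)%N - u N) < e) ->
  exists l : V, u @ \oo --> l.
Proof.
move=> h; apply/cvg_ex; apply: cauchy_cvg; apply: cauchy_exP => e e0.
have [N hN] : exists N, forall k, rnorm (u (N + k)%N - u N) < complex.Re e.
  by apply: h; rewrite -ltcR RRe_real ?gtr0_real.
exists (u N); exists N => // m /= Nm; rewrite -ball_normE/= normE.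
rewrite -[e]RRe_real ?gtr0_real// ltcR rdistrC.
by rewrite -(subnKC Nm).
Qed.

Lemma contraction_fixed_point (f : V -> V) (q : R) : 0 <= q -> q < 1 ->
  (forall x y, rnorm (f x - f y) <= q * rnorm (x - y)) -> exists x, f x = x.
Proof.
move=> q0 q1 fq; pose u n := iter n f 0.
pose D := rnorm (f 0) / (1 - q).
have q1' : 0 < 1 - q by rewrite subr_gt0.
have D0 : 0 <= D by rewrite divr_ge0 ?rnorm_ge0// ltW.
have uD n : rnorm (u n) <= D.
  elim: n => [|n IH]; first by rewrite /u/= rnorm0.
  rewrite /u/= -/(u n) -[f (u n)](subrK (f 0)).
  apply: le_trans (ler_rnormD _ _) _.
  have := fq (u n) 0; rewrite subr0 => h.
  have -> : D = q * D + rnorm (f 0) by rewrite /D; field; rewrite gt_eqF.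
  by rewrite lerD2r (le_trans h)// ler_wpM2l.
have un n k : rnorm (u (n + k)%N - u n) <= q ^+ n * D.
  elim: n => [|n IH]; first by rewrite add0n expr0 mul1r subr0.
  rewrite addSn /u/= -/(u _) -/(u n) exprS -mulrA.
  by apply: le_trans (fq _ _) _; rewrite ler_wpM2l.
have qn : (fun n => q ^+ n * D) @ \oo --> (0 : R).
  rewrite -(mul0r D); apply: cvgMl; apply: cvg_expr.
  by rewrite ger0_norm.
have [l ul] : exists l : V, u @ \oo --> l.
  apply: cauchy_seq_cvg => e e0.
  move/cvgrPdist_lt: qn => /(_ e e0)[N _ /(_ N (leqnn _))/=].
  rewrite sub0r normrN => h; exists N => k.
  by apply: le_lt_trans (un _ _) (le_lt_trans (ler_norm _) h).
exists l; apply/eqP; rewrite -subr_eq0 -rnorm_eq0 eq_le rnorm_ge0 andbT.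
apply/ler_addgt0Pr => e e0; rewrite add0r.
have e2 : 0 < e / 2 by rewrite divr_gt0.
move/rcvgP: ul => /(_ _ e2)[N _ hN].
apply: le_trans (ler_rdistD (f (u N)) _ _) _.
have h1 := hN N (leqnn N); have h2 := hN N.+1 (leqnSn N).
rewrite [e]splitr lerD//.
  apply: le_trans (fq _ _) _; apply: le_trans (ltW h1).
  by rewrite ler_piMl ?rnorm_ge0// ltW.
by rewrite rdistrC ltW.
Qed.

End FixedPoint.

Section ApproximateEigenvector.
Variables (R : realType) (H : hilbertType R) (T : bop H) (z : R[i]).
Hypotheses (Tcontr : forall x, rnorm (T x) <= rnorm x) (z1 : rnorm z = 1).

Lemma shiftB w x y : T (x - y) - w *: (x - y) = (T x - w *: x) - (T y - w *: y).
Proof.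
rewrite linearB scalerBr !opprB addrACA [RHS]addrACA; congr (_ + _).
by rewrite addrC.
Qed.

(** As the circle bounds the spectrum of a contraction, its spectral points are
    approximate eigenvalues: if [T - z] were bounded below by [e], then so would
    be [T - w] by [2e/3] for [w = (1 + e/3)z]; the latter is onto because
    [w] lies outside the unit disc, and a perturbation by [e/3] keeps it onto. *)
Lemma bounded_below_surj (e : R) : 0 < e ->
  (forall x, e * rnorm x <= rnorm (T x - z *: x)) ->
  forall y, exists x, T x - z *: x = y.
Proof.
move=> e0 Te; pose d := e / 3.
have d0 : 0 < d by rewrite divr_gt0.
pose w := (1 + d)%:C * z.
have d1 : 0 < 1 + d by rewrite addr_gt0.
have w1 : rnorm w = 1 + d by rewrite rnormM z1 mulr1 rnormR gtr0_norm.
have w0 : w != 0 by rewrite -rnorm_gt0 w1.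
have Tw_surj y : exists x, T x - w *: x = y.
  have [|||x xE] := @contraction_fixed_point _ H
    (fun x => w^-1 *: (T x - y)) (1 + d)^-1.
  - by rewrite invr_ge0 ltW.
  - by rewrite invf_lt1// ltrDl.
  - move=> x v; rewrite -scalerBr opprB addrA subrK -linearB rnormZ ler_pM ?rnorm_ge0//; last exact: Tcontr.
    rewrite -(@ler_pM2r _ (rnorm w)) ?w1// -{1}w1 -rnormM !mulVf ?rnorm1//.
    by rewrite gt_eqF.
  - exists x; have := congr1 ( *:%R w) xE.
    by rewrite scalerA mulfV// scale1r => <-; rewrite subKr.
have wE x : T x - w *: x = (T x - z *: x) - (d%:C * z) *: x.
  by rewrite /w rmorphD/= mulrDl mul1r scalerDl opprD addrA.
have Tw_below x : 2 * d * rnorm x <= rnorm (T x - w *: x).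
  have := Te x; rewrite -[T x - z *: x](subrK ((d%:C * z) *: x)) -wE => h.
  have := le_trans h (ler_rnormD _ _).
  rewrite rnormZ rnormM z1 mulr1 rnormR gtr0_norm//.
  have -> : e = 3 * d by rewrite /d; field.
  lra.
have [g gE] := choice Tw_surj.
move=> y.
have dd : 0 < 2 * d by rewrite mulr_gt0.
have [|||x xE] := @contraction_fixed_point _ H
    (fun x => g (y - (d%:C * z) *: x)) 2^-1.
- by rewrite invr_ge0.
- by rewrite invf_lt1// ltr1n.
- move=> x v; rewrite -(ler_pM2l dd); set a := g _; set b := g _.
  apply: le_trans (Tw_below _) _.
  rewrite shiftB !gE opprB addrC subrKA -scalerBr.
  rewrite rnormZ rnormM z1 mulr1 rnormR gtr0_norm// rdistrC.
  by rewrite mulrA (mulrC 2 d) mulfK.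
exists x; have := gE (y - (d%:C * z) *: x); rewrite xE wE.
by move/addIr.
Qed.

Lemma approximate_eigenvector (e : R) : spectrum T z -> 0 < e ->
  exists2 x, rnorm x = 1 & rnorm (T x - z *: x) < e.
Proof.
move=> Tz e0; apply: contrapT => noev; apply: Tz.
have Te x : e * rnorm x <= rnorm (T x - z *: x).
  have [->|x0] := eqVneq x 0; first by rewrite rnorm0 mulr0 rnorm_ge0.
  have nx : 0 < rnorm x by rewrite rnorm_gt0.
  rewrite leNgt; apply/negP => h; apply: noev.
  exists ((rnorm x)^-1%:C *: x).
    by rewrite rnormZ rnormR ger0_norm ?mulVf ?gt_eqF// invr_ge0 ltW.
  rewrite linearZ/= scalerA mulrC -scalerA -scalerBr rnormZ rnormR.
  by rewrite ger0_norm ?invr_ge0 ?(ltW nx)// mulrC ltr_pdivrMr.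
have [g gE] := choice (bounded_below_surj e0 Te).
have inj x y : T x - z *: x = T y - z *: y -> x = y.
  move=> xy; apply/eqP; rewrite -subr_eq0 -rnorm_eq0 eq_le rnorm_ge0 andbT.
  rewrite -(ler_pM2l e0) mulr0 (le_trans (Te _))//.
  by rewrite shiftB xy subrr rnorm0.
have glin : linear g.
  move=> a x y; apply: inj; rewrite gE linearP scalerDr opprD addrACA gE.
  by rewrite scalerA mulrC -scalerA -scalerBr gE.
have [x|S SE] := @bop_of_bounded _ H g e^-1 glin.
  by rewrite -(ler_pM2l e0) mulVKf ?gt_eqF// (le_trans (Te _))// gE.
exists S; split => x; rewrite !SE ?gE//.
by apply: inj; rewrite gE.
Qed.

(** An approximate eigenvector almost attains its eigenvalue in the numerical
    range, the form in which inner products of elementary tensors use it. *)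
Lemma numerical_range_dense (e : R) : spectrum T z -> 0 < e ->
  exists2 x, rnorm x = 1 & rnorm (ip (T x) x - z) < e.
Proof.
move=> Tz e0; have [x x1 xe] := approximate_eigenvector Tz e0.
exists x => //; apply: le_lt_trans xe.
have -> : ip (T x) x - z = ip (T x - z *: x) x.
  by rewrite ipBl ipZl ipxx x1 expr1n mulr1.
by apply: le_trans (ip_le _ _) _; rewrite x1 mulr1.
Qed.

End ApproximateEigenvector.

(** * Tensor products of contractions *)

Section ExtendContraction.
Variables (R : realType) (K : hilbertType R) (D : K -> K -> Prop).
Hypotheses (D0 : D 0 0).
Hypotheses (D_linear : forall (a : R[i]) p q p' q',
  D p q -> D p' q' -> D (a *: p + p') (a *: q + q')).
Hypotheses (D_contr : forall p q, D p q -> rnorm q <= rnorm p).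
Hypotheses (D_dense : forall y (e : R), 0 < e ->
  exists p q, D p q /\ rnorm (y - p) < e).

(** The closure of the relation [D]. *)
Let G y z := forall e : R, 0 < e ->
  exists p q, [/\ D p q, rnorm (y - p) < e & rnorm (z - q) < e].

Let D_dist p q p' q' : D p q -> D p' q' -> rnorm (q - q') <= rnorm (p - p').
Proof.
move=> h h'; rewrite [p - p']addrC [q - q']addrC -[- p']scaleN1r -[- q']scaleN1r.
exact/D_contr/D_linear.
Qed.

Let triangle (b a c : K) : rnorm (a - c) <= rnorm (a - b) + rnorm (b - c).
Proof. exact: ler_rdistD. Qed.

Let G_dist y z y' z' : G y z -> G y' z' -> rnorm (z - z') <= rnorm (y - y').
Proof.
move=> h h'; apply/ler_addgt0Pr => e e0.
have e4 : 0 < e / 4 by rewrite divr_gt0.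
have [p [q [Dpq yp zq]]] := h _ e4; have [p' [q' [Dpq' yp' zq']]] := h' _ e4.
have := D_dist Dpq Dpq'.
have := triangle q z z'; have := triangle q' q z'.
have := triangle y p p'; have := triangle y' y p'.
rewrite (rdistrC q' z') (rdistrC p y).
lra.
Qed.

Let G_total y : exists z, G y z.
Proof.
have /choice[u uP] N : exists pq : K * K, D pq.1 pq.2 /\ rnorm (y - pq.1) < N.+1%:R^-1.
  by have [|p [q h]] := @D_dense y N.+1%:R^-1; [rewrite invr_gt0|exists (p, q)].
have uN (e : R) : 0 < e -> exists N, forall k, rnorm (y - (u (N + k)%N).1) < e.
  move=> e0; have [N _ hN] := near_infty_natSinv_lt (PosNum e0).
  exists N => k; apply: lt_trans (uP _).2 _.
  by apply: (hN (N + k)%N); rewrite /= leq_addr.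
have [z uz] : exists z : K, (fun N => (u N).2) @ \oo --> z.
  apply: cauchy_seq_cvg => e e0.
  have [|N hN] := uN (e / 2); first by rewrite divr_gt0.
  exists N => k; apply: le_lt_trans (D_dist (uP _).1 (uP _).1) _.
  have := triangle y (u (N + k)%N).1 (u N).1.
  have := hN 0%N; rewrite addn0; have := hN k; rewrite rdistrC; lra.
exists z => e e0; have [N hN] := uN e e0.
move/rcvgP: uz => /(_ e e0)[M _ hM].
exists (u (N + M)%N).1, (u (N + M)%N).2; split; [exact: (uP _).1|exact: hN|].
by apply: hM; rewrite /= leq_addl.
Qed.

Let G_linear (a : R[i]) y z y' z' : G y z -> G y' z' -> G (a *: y + y') (a *: z + z').
Proof.
move=> h h' e e0.
have a1 : 0 < rnorm a + 1 by rewrite ltr_wpDl ?rnorm_ge0.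
have e1 : 0 < e / (2 * (rnorm a + 1)) by rewrite divr_gt0// mulr_gt0.
have e2 : 0 < e / 2 by rewrite divr_gt0.
have [p [q [Dpq yp zq]]] := h _ e1; have [p' [q' [Dpq' yp' zq']]] := h' _ e2.
have est v w v' w' : rnorm (v - w) < e / (2 * (rnorm a + 1)) ->
    rnorm (v' - w') < e / 2 -> rnorm (a *: v + v' - (a *: w + w')) < e.
  move=> vw vw'; rewrite opprD addrACA -scalerBr.
  apply: le_lt_trans (ler_rnormD _ _) _; rewrite rnormZ.
  rewrite [ltRHS]splitr ler_ltD//.
  move: vw; rewrite ltr_pdivlMr ?mulr_gt0// => vw.
  have := rnorm_ge0 (v - w); have := rnorm_ge0 a; nra.
exists (a *: p + p'), (a *: q + q'); split; [exact: D_linear|exact: est|exact: est].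
Qed.

(** By [D_contr] and completeness the closure of [D] is the graph of a function,
    and this function inherits linearity and the bound from [D]. *)
Lemma extend_contraction : exists A : bop K,
  (forall y, rnorm (A y) <= rnorm y) /\ (forall p q, D p q -> A p = q).
Proof.
have [f fG] := choice G_total.
have GD p q : D p q -> G p q.
  by move=> h e e0; exists p, q; split; rewrite // subrr rnorm0.
have G_fun y z : G y z -> f y = z.
  move=> h; apply/eqP; rewrite -subr_eq0 -rnorm_eq0 eq_le rnorm_ge0 andbT.
  by rewrite (le_trans (G_dist (fG y) h))// subrr rnorm0.
have fl : linear f by move=> a y y'; apply: G_fun; exact: G_linear.
have fc y : rnorm (f y) <= rnorm y.
  by have := G_dist (fG y) (GD _ _ D0); rewrite !subr0.
have [y|A AE] := @bop_of_bounded _ K f 1 fl; first by rewrite mul1r.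
exists A; split=> [y|p q Dpq]; first by rewrite AE.
by rewrite AE; apply/G_fun/GD.
Qed.

End ExtendContraction.

Section GramKernels.
Variables (R : realType) (H : hilbertType R) (I : finType) (x : I -> H).

Lemma ip_sum2 (c d : I -> R[i]) (y : I -> H) :
  ip (\sum_j c j *: x j) (\sum_l d l *: y l) =
  \sum_j \sum_l c j * conjc (d l) * ip (x j) (y l).
Proof.
rewrite ip_suml; apply: eq_bigr => j _; rewrite ip_sumr; apply: eq_bigr => l _.
by rewrite ipZl ipZr mulrA.
Qed.

Lemma gram_ip : gram (fun j l => ip (x j) (x l)).
Proof.
apply: psd_gram; split=> [j l|c]; first exact: ipC.
by rewrite -ip_sum2 ipxx_ge0.
Qed.

Lemma gram_ip_contr (T : bop H) : (forall x, rnorm (T x) <= rnorm x) ->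
  gram (fun j l => ip (x j) (x l) - ip (T (x j)) (T (x l))).
Proof.
move=> Tc; apply: psd_gram; split=> [j l|c].
  by rewrite rmorphB/= -!ipC.
under eq_bigr do under eq_bigr do rewrite mulrBr.
under eq_bigr do rewrite sumrB.
rewrite sumrB -ip_sum2.
have -> : \sum_j \sum_l c j * conjc (c l) * ip (T (x j)) (T (x l)) =
    ip (T (\sum_j c j *: x j)) (T (\sum_j c j *: x j)).
  rewrite linear_sum ip_suml; apply: eq_bigr => j _.
  rewrite ip_sumr; apply: eq_bigr => l _.
  by rewrite !linearZ ipZl ipZr mulrA.
by rewrite subr_ge0 !ipxx lecR ler_sqr ?nnegrE ?rnorm_ge0.
Qed.

End GramKernels.

Section Tensor.
Variables (R : realType) (n : nat) (H : 'I_n -> hilbertType R) (K : hilbertType R).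
Variables (tau : (forall i, H i) -> K) (tauP : hilbert_tensor tau).

Lemma ip_tau x y : ip (tau x) (tau y) = \prod_(i < n) ip (x i) (y i).
Proof. exact: tensor_dot. Qed.

(** A finite family in the algebraic tensor product, written with common
    elementary tensors. *)
Definition algebraic (Q : finType) (v : Q -> K) :=
  exists (I : finType) (X : I -> forall i, H i) (c : Q -> I -> R[i]),
    forall q, v q = \sum_j c q j *: tau (X j).

Lemma algebraic_dense (Q : finType) (y : Q -> K) : exists u : nat -> Q -> K,
  (forall N, algebraic (u N)) /\ forall q, (fun N => u N q) @ \oo --> y q.
Proof.
have /choice[u uP] N : exists v : Q -> K, algebraic v /\
    forall q, rnorm (y q - v q) < N.+1%:R^-1.
  have /choice[s sP] q : exists s : {m & (('I_m -> R[i]) * ('I_m -> forall i, H i))%type},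
      rnorm (y q - \sum_j (tagged s).1 j *: tau ((tagged s).2 j)) < N.+1%:R^-1.
    have : closure [set y : K | exists m (c : 'I_m -> R[i])
        (x : 'I_m -> forall i, H i), y = \sum_(j < m) c j *: tau (x j)] (y q).
      by rewrite (tensor_dense tauP).
    have e0 : 0 < (N.+1%:R^-1 : R)%:C by rewrite ltcR invr_gt0.
    move=> /(_ _ (nbhsx_ballx (y q) _ e0))[_ [[m [c [x ->]]]]].
    rewrite -ball_normE/= normE ltcR => h.
    by exists (existT _ m (c, x)).
  exists (fun q => \sum_j (tagged (s q)).1 j *: tau ((tagged (s q)).2 j)).
  split=> //.
  exists {q : Q & 'I_(tag (s q))}, (fun p => (tagged (s (tag p))).2 (tagged p)),
    (fun q p => if tag p == q then (tagged (s (tag p))).1 (tagged p) else 0) => q.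
  rewrite -(sig_big_dep (fun=> true) (fun _ _ => true) (fun q' (j : 'I_(tag (s q'))) =>
    (if q' == q then (tagged (s q')).1 j else 0) *: tau ((tagged (s q')).2 j)))/=.
  rewrite [RHS](bigD1 q)//= eqxx [X in _ + X]big1 ?addr0// => q' q'q.
  by rewrite big1// => j _; rewrite (negPf q'q) scale0r.
exists u; split=> [N|q]; first exact: (uP N).1.
apply/rcvgP => e e0; have [M _ hM] := near_infty_natSinv_lt (PosNum e0).
by exists M => // N MN; apply: lt_trans ((uP N).2 q) (hM N MN).
Qed.

(** The Gram kernel of the vectors [S i x] is dominated by that of the vectors [x]
    in each factor, hence also after entrywise multiplication over the factors. *)
Lemma algebraic_contr (S : forall i, bop (H i)) (I : finType) (c : I -> R[i])
    (X : I -> forall i, H i) : (forall i x, rnorm (S i x) <= rnorm x) ->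
  rnorm (\sum_j c j *: tau (fun i => S i (X j i))) <= rnorm (\sum_j c j *: tau (X j)).
Proof.
move=> Sc; rewrite -(ler_pXn2r (n := 2))// ?nnegrE ?rnorm_ge0//.
rewrite -lecR -!ipxx !ip_sum2 -subr_ge0 -sumrB.
under eq_bigr do rewrite -sumrB.
under eq_bigr do under eq_bigr do rewrite -mulrBr !ip_tau.
apply: gram_sum_ge0; apply: gram_prodB => i.
  exact: gram_ip.
exact: gram_ip_contr.
Qed.

(** [tensor_op] is a choice among the operators with a given effect on elementary
    tensors, and says nothing until one such operator is known. *)
Lemma tensor_op_exists (S : forall i, bop (H i)) :
  (forall i x, rnorm (S i x) <= rnorm x) -> exists A : bop K,
  (forall y, rnorm (A y) <= rnorm y) /\
  (forall x, A (tau x) = tau (fun i => S i (x i))).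
Proof.
move=> Sc.
pose D p q := exists (I : finType) (X : I -> forall i, H i) (c : I -> R[i]),
  p = \sum_j c j *: tau (X j) /\ q = \sum_j c j *: tau (fun i => S i (X j i)).
have [||||A [Ac AD]] := @extend_contraction _ K D.
- exists void, (fun v : void => match v with end), (fun=> 0).
  by rewrite !big_pred0// => -[].
- move=> a p q p' q' [I [X [c [-> ->]]]] [I' [X' [c' [-> ->]]]].
  exists (I + I')%type, (fun s => match s with inl j => X j | inr j => X' j end).
  exists (fun s => match s with inl j => a * c j | inr j => c' j end).
  rewrite !big_sumType/= !scaler_sumr.
  by split; congr (_ + _); apply: eq_bigr => j _; rewrite scalerA.
- by move=> _ _ [I [X [c [-> ->]]]]; exact: algebraic_contr.
- move=> y e e0; have [u [ua uy]] := algebraic_dense (fun _ : unit => y).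
  move/rcvgP: (uy tt) => /(_ e e0)[N _ /(_ N (leqnn N)) hN].
  have [I [X [c uE]]] := ua N.
  exists (u N tt), (\sum_j c tt j *: tau (fun i => S i (X j i))); split => //.
  by exists I, X, (c tt); rewrite uE.
exists A; split=> // x; apply: AD.
exists unit, (fun=> x), (fun=> 1).
by rewrite !(big_pred1 tt) ?scale1r//; case.
Qed.

Lemma tensor_opE (S : forall i, bop (H i)) x :
  (forall i x, rnorm (S i x) <= rnorm x) ->
  tensor_op tau S (tau x) = tau (fun i => S i (x i)).
Proof.
move=> /tensor_op_exists[A [_ AE]].
by have /= := @xgetPex _ 0 [set A : bop K | forall x, A (tau x) =
  tau (fun i => S i (x i))] (ex_intro _ A AE); apply.
Qed.

Lemma tensor_op_contr (S : forall i, bop (H i)) y :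
  (forall i x, rnorm (S i x) <= rnorm x) -> rnorm (tensor_op tau S y) <= rnorm y.
Proof.
move=> Sc; have [A [Ac AE]] := tensor_op_exists Sc.
suff -> : tensor_op tau S y = A y by [].
have [u [ua uy]] := algebraic_dense (fun _ : unit => y).
have cB (B : bop K) : (fun N => B (u N tt)) @ \oo --> B y.
  by apply: continuous_cvg (uy tt); exact: bop_continuous.
apply: (cvg_unique _ (cB _)) => //.
suff -> : (fun N => tensor_op tau S (u N tt)) = (fun N => A (u N tt)) by exact: cB.
apply/funext => N; have [I [X [c ->]]] := ua N.
rewrite !linear_sum; apply: eq_bigr => j _.
by rewrite !linearZ/= tensor_opE// AE.
Qed.

End Tensor.

(** * Bounds for sesquilinear expressions *)

Section RealSums.
Variable R : realType.

Lemma Re_sum (I : Type) (r : seq I) (P : pred I) (F : I -> R[i]) :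
  complex.Re (\sum_(i <- r | P i) F i) = \sum_(i <- r | P i) complex.Re (F i).
Proof. by elim/big_rec2: _ => // i y x _ <-; case: (F i) x => ? ? []. Qed.

Lemma Re_mulR (a : R) (z : R[i]) : complex.Re (a%:C * z) = a * complex.Re z.
Proof. by case: z => x y /=; rewrite mul0r subr0. Qed.

(** Expand the sum of the squares of [B f - A g], with [A] and [B] the two norms. *)
Lemma sum_mul_le (I : finType) (f g : I -> R) :
  \sum_i f i * g i <= Num.sqrt (\sum_i f i ^+ 2) * Num.sqrt (\sum_i g i ^+ 2).
Proof.
have sq0 (h : I -> R) : 0 <= \sum_i h i ^+ 2 by apply: sumr_ge0 => i _; exact: sqr_ge0.
have zero (h h' : I -> R) : Num.sqrt (\sum_i h i ^+ 2) = 0 -> \sum_i h i * h' i = 0.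
  move=> /eqP; rewrite sqrtr_eq0 => h0; apply: big1 => i _.
  suff : h i ^+ 2 == 0 by rewrite expf_eq0/= => /eqP->; rewrite mul0r.
  have := le_anti (introT andP (conj h0 (sq0 h))) => /eqP.
  by rewrite psumr_eq0 => [|j _]; [move=> /allP/(_ i); rewrite mem_index_enum; apply|exact: sqr_ge0].
have := sqr_sqrtr (sq0 f); have := sqr_sqrtr (sq0 g).
have := sqrtr_ge0 (\sum_i f i ^+ 2); have := sqrtr_ge0 (\sum_i g i ^+ 2).
have zf := zero f g; have := zero g f.
set A := Num.sqrt _ in zf *; set B := Num.sqrt _ => zg B0 A0 BE AE.
have [A00|A1] := eqVneq A 0; first by rewrite zf// A00 mul0r.
have [B00|B1] := eqVneq B 0.
  by under eq_bigr do rewrite mulrC; rewrite zg// B00 mulr0.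
have AB : 0 < A * B by rewrite mulr_gt0// lt_def ?A1 ?B1.
have : 0 <= \sum_i (B * f i - A * g i) ^+ 2.
  by apply: sumr_ge0 => i _; exact: sqr_ge0.
have -> : \sum_i (B * f i - A * g i) ^+ 2 =
    B ^+ 2 * \sum_i f i ^+ 2 + A ^+ 2 * \sum_i g i ^+ 2 - 2 * (A * B) * \sum_i f i * g i.
  rewrite !mulr_sumr -big_split -sumrB; apply: eq_bigr => i _ /=.
  by ring.
rewrite -AE -BE => h; rewrite -(ler_pM2l AB); nra.
Qed.

Definition kernel_form (I : finType) (P : I -> I -> R[i]) (c d : I -> R[i]) : R[i] :=
  \sum_j \sum_l c j * conjc (d l) * P j l.

Lemma kernel_form_sum (I S : finType) (w : S -> R[i]) (P : S -> I -> I -> R[i]) c d :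
  \sum_s w s * kernel_form (P s) c d = kernel_form (fun j l => \sum_s w s * P s j l) c d.
Proof.
rewrite /kernel_form; under eq_bigr do rewrite mulr_sumr.
rewrite exchange_big; apply: eq_bigr => j _.
under eq_bigr do rewrite mulr_sumr.
rewrite exchange_big; apply: eq_bigr => l _.
by rewrite mulr_sumr; apply: eq_bigr => s _; rewrite mulrCA.
Qed.

Lemma eq_kernel_form (I : finType) (P Q : I -> I -> R[i]) c d : P =2 Q ->
  kernel_form P c d = kernel_form Q c d.
Proof. by move=> e; apply: eq_bigr => j _; apply: eq_bigr => l _; rewrite e. Qed.

(** A bound on the form of a scalar matrix [B] passes to the form of [B (x) 1] on
    the space with Gram kernel [P]: decompose [P] into kernels of rank one and add
    up the bounds. *)
Lemma gram_bound (I : finType) (P : I -> I -> R[i]) (k : nat)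
    (B : 'I_k -> 'I_k -> R[i]) (m : R) : gram P ->
  (forall c d : 'I_k -> R[i],
    2 * complex.Re (\sum_a (\sum_b B a b * c b) * conjc (d a)) <=
      m * (\sum_b rnorm (c b) ^+ 2 + \sum_a rnorm (d a) ^+ 2)) ->
  forall c d : 'I_k -> I -> R[i],
    2 * complex.Re (\sum_a \sum_b B a b * kernel_form P (c b) (d a)) <=
    m * (\sum_b complex.Re (kernel_form P (c b) (c b)) +
         \sum_a complex.Re (kernel_form P (d a) (d a))).
Proof.
move=> [S [u PE]] hB c d.
have E c' d' : kernel_form P c' d' =
    \sum_p (\sum_j c' j * u p j) * conjc (\sum_l d' l * u p l).
  rewrite /kernel_form.
  under eq_bigr do under eq_bigr do rewrite PE mulr_sumr.
  under eq_bigr do rewrite exchange_big/=.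
  rewrite exchange_big; apply: eq_bigr => p _.
  rewrite rmorph_sum/= mulr_suml; apply: eq_bigr => j _.
  by rewrite mulr_sumr; apply: eq_bigr => l _; rewrite rmorphM/= mulrACA.
have -> : \sum_a \sum_b B a b * kernel_form P (c b) (d a) =
    \sum_p \sum_a (\sum_b B a b * (\sum_j c b j * u p j)) *
      conjc (\sum_l d a l * u p l).
  rewrite [RHS]exchange_big; apply: eq_bigr => a _.
  under [LHS]eq_bigr do rewrite E mulr_sumr.
  rewrite exchange_big; apply: eq_bigr => p _.
  by rewrite mulr_suml; apply: eq_bigr => b _; rewrite mulrA.
have EE (e : 'I_k -> I -> R[i]) : \sum_b complex.Re (kernel_form P (e b) (e b)) =
    \sum_p \sum_b rnorm (\sum_j e b j * u p j) ^+ 2.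
  rewrite [RHS]exchange_big; apply: eq_bigr => b _; rewrite E Re_sum.
  by apply: eq_bigr => p _; rewrite mulcJ.
rewrite !EE Re_sum -big_split !mulr_sumr/=.
by apply: ler_sum => p _; exact: hB.
Qed.

Lemma prod_dist_le (I : Type) (r : seq I) (a b : I -> R[i]) :
  (forall i, rnorm (a i) <= 1) -> (forall i, rnorm (b i) <= 1) ->
  rnorm (\prod_(i <- r) a i - \prod_(i <- r) b i) <= \sum_(i <- r) rnorm (a i - b i).
Proof.
move=> a1 b1; elim: r => [|i r IH]; first by rewrite !big_nil subrr rnorm0.
rewrite !big_cons; set p := \prod_(j <- r) _ in IH *; set q := \prod_(j <- r) _ in IH *.
have -> : a i * p - b i * q = (a i - b i) * q + a i * (p - q) by ring.
apply: le_trans (ler_rnormD _ _) _; rewrite !rnormM lerD//.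
  rewrite ler_piMr ?rnorm_ge0// /q rnorm_prod.
  by apply: prodr_ile1 => j _; rewrite rnorm_ge0 b1.
by rewrite (le_trans _ IH)// ler_piMl ?rnorm_ge0.
Qed.

End RealSums.

Section L2norm.
Variable R : realType.

Lemma l2norm_ge0 (V : normedZmodType R[i]) k (x : 'cV[V]_k) : 0 <= l2norm x.
Proof. exact: sqrtr_ge0. Qed.

Lemma sqr_l2norm (V : normedZmodType R[i]) k (x : 'cV[V]_k) :
  l2norm x ^+ 2 = \sum_i rnorm (x i 0) ^+ 2.
Proof. by rewrite sqr_sqrtr// sumr_ge0// => i _; exact: sqr_ge0. Qed.

Lemma l2norm_scale (V : normedZmodType R[i]) k (t : R) (x y : 'cV[V]_k) : 0 <= t ->
  (forall i, rnorm (y i 0) = t * rnorm (x i 0)) -> l2norm y = t * l2norm x.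
Proof.
move=> t0 h; rewrite -[t in RHS]ger0_norm// -sqrtr_sqr /l2norm -sqrtrM ?sqr_ge0//.
congr Num.sqrt; rewrite mulr_sumr; apply: eq_bigr => i _.
by rewrite h exprMn.
Qed.

Lemma mx_opnorm_leP k (A : 'M[R[i]]_k) (m : R) : 0 <= m ->
  (mx_opnorm A <= m%:E)%E <-> forall x : 'cV_k, l2norm (A *m x) <= m * l2norm x.
Proof.
apply: (@ball_sup_leP R 'cV[R[i]]_k (fun t x => t%:C *: x)
  (fun x => l2norm (A *m x)) (fun x => l2norm x)).
- by move=> x; exact: l2norm_ge0.
- move=> t x t0; apply: l2norm_scale => // i.
  by rewrite -scalemxAr mxE rnormM rnormR ger0_norm.
- by move=> t x t0; apply: l2norm_scale => // i; rewrite mxE rnormM rnormR ger0_norm.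
Qed.

Lemma bopmx_norm_leP (K : hilbertType R) k (A : 'M[bop K]_k) (m : R) : 0 <= m ->
  (bopmx_norm A <= m%:E)%E <->
  forall x : 'cV[K]_k, l2norm (\col_i \sum_j A i j (x j 0)) <= m * l2norm x.
Proof.
apply: (@ball_sup_leP R 'cV[K]_k (fun t x => \col_i (t%:C *: x i 0))
  (fun x => l2norm (\col_i \sum_j A i j (x j 0))) (fun x => l2norm x)).
- by move=> x; exact: l2norm_ge0.
- move=> t x t0; apply: l2norm_scale => // i.
  rewrite -[t in RHS]ger0_norm// -rnormR -rnormZ; congr rnorm.
  rewrite !mxE scaler_sumr; apply: eq_bigr => j _.
  by rewrite !mxE linearZ.
- by move=> t x t0; apply: l2norm_scale => // i; rewrite mxE rnormZ rnormR ger0_norm.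
Qed.

Lemma mx_opnorm_ge0 k (A : 'M[R[i]]_k) : (0 <= mx_opnorm A)%E.
Proof.
apply: le_trans (ereal_sup_ubound _); last first.
  exists 0 => //=; rewrite /l2norm big1 ?sqrtr0// => i _.
  by rewrite mxE rnorm0 expr0n.
by rewrite lee_fin l2norm_ge0.
Qed.

Lemma bopmx_norm_ge0 (K : hilbertType R) k (A : 'M[bop K]_k) : (0 <= bopmx_norm A)%E.
Proof.
apply: le_trans (ereal_sup_ubound _); last first.
  exists 0 => //=; rewrite /l2norm big1 ?sqrtr0// => i _.
  by rewrite mxE rnorm0 expr0n.
by rewrite lee_fin l2norm_ge0.
Qed.

Lemma ereal_le_ge0 (a b : \bar R) : (0 <= b)%E ->
  (forall m : R, 0 < m -> (b <= m%:E)%E -> (a <= m%:E)%E) -> (a <= b)%E.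
Proof.
case: b => [b||]//; last by move=> _ _; exact: leey.
rewrite lee_fin => b0 h; apply/lee_addgt0Pr => e e0.
rewrite -EFinD; apply: h; first by rewrite ltr_wpDl.
by rewrite lee_fin lerDl ltW.
Qed.

End L2norm.

Lemma cvg_fin_sum (F : numFieldType) (V : normedModType F) (I : finType)
    (u : I -> nat -> V) (l : I -> V) :
  (forall i, u i @ \oo --> l i) -> (fun N => \sum_i u i N) @ \oo --> \sum_i l i.
Proof.
by move=> ul; apply: cvg_big => [|i _]; [exact: add_continuous|exact: ul].
Qed.

Section Limits.
Variables (R : realType) (H : hilbertType R).

Lemma cvg_rnorm (u : nat -> H) x : u @ \oo --> x ->
  (fun N => rnorm (u N)) @ \oo --> rnorm x.
Proof.
move=> /rcvgP ux; apply/cvgrPdist_lt => e /ux; apply: filterS => N.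
apply: le_lt_trans; have tri (a b : H) : rnorm a <= rnorm b + rnorm (a - b).
  by rewrite -{1}[a](subrK b) [leRHS]addrC ler_rnormD.
have := tri x (u N); have := tri (u N) x; rewrite (rdistrC (u N)) ler_norml.
lra.
Qed.

Lemma cvg_Re_ip (u v : nat -> H) x y : u @ \oo --> x -> v @ \oo --> y ->
  (fun N => complex.Re (ip (u N) (v N))) @ \oo --> complex.Re (ip x y).
Proof.
have E a b : complex.Re (ip a b) =
    2^-1 * (rnorm a ^+ 2 + rnorm b ^+ 2 - rnorm (a - b) ^+ 2 : R).
  by rewrite sqr_rnormB; field.
move=> ux vy; under eq_fun do rewrite E; rewrite E.
have sq (w : nat -> H) z : w @ \oo --> z ->
    (fun N => rnorm (w N) ^+ 2) @ \oo --> rnorm z ^+ 2.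
  by move=> /cvg_rnorm wz; exact: (cvgM wz wz).
apply: cvgMr; apply: cvgB; last by apply: sq; exact: (cvgB ux vy).
by apply: cvgD; exact: sq.
Qed.

Lemma lim_le (u : nat -> R) (l M : R) : u @ \oo --> l -> (forall N, u N <= M) -> l <= M.
Proof.
by move=> ul h; rewrite -(cvg_lim _ ul)//; apply: limr_le; [apply/cvg_ex; exists l|exact: nearW].
Qed.

End Limits.

(** * Tensor products over families of index sets *)

Section SubsetTensor.
Variables (R : realType) (n : nat) (H : 'I_n -> hilbertType R) (K : hilbertType R).
Variables (tau : (forall i, H i) -> K) (tauP : hilbert_tensor tau).
Variables (T : forall i, bop (H i)).
Hypothesis Tc : forall i x, rnorm (T i x) <= rnorm x.
Variable J : 'I_n -> 'I_n -> bool.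

Definition subset_tensor i : bop K :=
  tensor_op tau (fun j => if J i j then T j else idop (H j)).

(** [f_map] is the case [J i = {i}], and [g_map] the case [J i = {0, .., i}]. *)
Definition subset_map (a : l1 R n) : bop K :=
  \sum_(i < n) l1coord a i *: subset_tensor i.

Let factor_contr i j (x : H j) :
  rnorm ((if J i j then T j else idop (H j)) x) <= rnorm x.
Proof. by case: ifP => // _; exact: Tc. Qed.

Lemma subset_tensor_contr i y : rnorm (subset_tensor i y) <= rnorm y.
Proof. by apply: tensor_op_contr => // j x; exact: factor_contr. Qed.

Lemma ip_subset_tensor i x y : ip (subset_tensor i (tau x)) (tau y) =
  \prod_j (if J i j then ip (T j (x j)) (y j) else ip (x j) (y j)).
Proof.
rewrite tensor_opE//.
by rewrite (ip_tau tauP); apply: eq_bigr => j _; case: ifP.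
Qed.

Lemma subset_mapE a y :
  subset_map a y = \sum_i l1coord a i *: subset_tensor i y.
Proof.
rewrite /subset_map; pose ev (A : bop K) := A y.
by rewrite -[LHS]/(ev _) (big_morph ev (id1 := 0) (op1 := +%R)).
Qed.

Lemma subset_map_linear : linear subset_map.
Proof.
move=> t a b; rewrite /subset_map scaler_sumr -big_split; apply: eq_bigr => i _ /=.
by rewrite /l1coord !mxE scalerDl scalerA.
Qed.

Section UpperBound.
Variables (k : nat) (v : 'M[l1 R n]_k) (m : R).
Hypothesis scalar_bound : forall z : 'I_n -> R[i], (forall j, rnorm (z j) = 1) ->
  forall c d : 'I_k -> R[i],
  2 * complex.Re (\sum_a (\sum_b
    (\sum_i l1coord (v a b) i * \prod_j (if J i j then z j else 1)) * c b) * conjc (d a))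
  <= m * (\sum_b rnorm (c b) ^+ 2 + \sum_a rnorm (d a) ^+ 2).

(** Multiply out [\prod_t \sum_s p_s] over the tensor factors [t]. Each choice [s]
    of sample points contributes the scalar matrix at the point [w o s] of the
    torus, weighted by a product of positive kernels; the damping factor
    [(N / N.+1) ^+ #|J i|] comes from one factor [N / N.+1] for each [T t] in the
    [i]-th tensor. *)
Lemma fejer_bound (N : nat) (I : finType) (X : I -> forall i, H i)
    (c d : 'I_k -> I -> R[i])
    (xi := fun b => \sum_j c b j *: tau (X j))
    (eta := fun a => \sum_j d a j *: tau (X j)) :
  2 * (\sum_i (N%:R / N.+1%:R) ^+ #|J i| * complex.Re (\sum_a \sum_b
        l1coord (v a b) i * ip (subset_tensor i (xi b)) (eta a)))
  <= m * (\sum_b rnorm (xi b) ^+ 2 + \sum_a rnorm (eta a) ^+ 2).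
Proof.
have [w [w1 wP]] := unity_quadrature R (ltn0Sn N.+1).
pose kappa t s j l := fejer_kernel (T t) w s (X j t) (X l t).
pose kap (s : {ffun 'I_n -> 'I_N.+2}) j l := \prod_t kappa t (s t) j l.
pose chi i (s : {ffun 'I_n -> 'I_N.+2}) := \prod_t (if J i t then w (s t) else 1).
have kap_gram s : gram (kap s).
  apply: gram_prod => t; apply: fejer_gram; [exact: bop_linear|exact: Tc|].
  by rewrite invr_ge0 ler0n.
have kapE j l : \sum_s 1 * kap s j l = ip (tau (X j)) (tau (X l)).
  under eq_bigr do rewrite mul1r.
  rewrite (ip_tau tauP) -(bigA_distr_bigA (fun t s => kappa t s j l)).
  apply: eq_bigr => t _; exact: sum_fejer_kernel.
have chiE i j l : \sum_s chi i s * kap s j l =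
    ((N%:R / N.+1%:R) ^+ #|J i|)%:C * ip (subset_tensor i (tau (X j))) (tau (X l)).
  under eq_bigr do rewrite -big_split/=.
  rewrite -(bigA_distr_bigA (fun t s => (if J i t then w s else 1) * kappa t s j l)).
  rewrite ip_subset_tensor rmorphXn rmorphM fmorphV !rmorph_nat/= -prodr_const.
  rewrite [X in _ = X * _]big_mkcond -big_split; apply: eq_bigr => t _ /=.
  rewrite unfold_in; case: ifP => _; first exact: sum_wfejer_kernel.
  by under eq_bigr do rewrite mul1r; rewrite mul1r; exact: sum_fejer_kernel.
have ipE (c' d' : I -> R[i]) :
    kernel_form (fun j l => \sum_s 1 * kap s j l) c' d' =
    ip (\sum_j c' j *: tau (X j)) (\sum_j d' j *: tau (X j)).
  by rewrite ip_sum2; apply: eq_kernel_form.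
have sqE (e : 'I_k -> I -> R[i]) :
    \sum_s \sum_b complex.Re (kernel_form (kap s) (e b) (e b)) =
    \sum_b rnorm (\sum_j e b j *: tau (X j)) ^+ 2.
  rewrite exchange_big; apply: eq_bigr => b _.
  rewrite -Re_sum; under eq_bigr do rewrite -[kernel_form _ _ _]mul1r.
  by rewrite kernel_form_sum ipE ipxx.
have bound s := gram_bound (kap_gram s) (scalar_bound (fun t => w1 (s t))) c d.
have := ler_sum (P := xpredT) (index_enum _) (fun s _ => bound s).
move=> /=; rewrite -!mulr_sumr big_split/= !sqE -Re_sum -/(xi _) -/(eta _).
congr (2 * _ <= _).
under [RHS]eq_bigr do rewrite -Re_mulR; rewrite -Re_sum; congr complex.Re.
under [RHS]eq_bigr do rewrite mulr_sumr.
rewrite exchange_big [RHS]exchange_big; apply: eq_bigr => a _ /=.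
under [RHS]eq_bigr do rewrite mulr_sumr.
rewrite exchange_big [RHS]exchange_big; apply: eq_bigr => b _ /=.
under eq_bigr do rewrite mulr_suml.
rewrite exchange_big; apply: eq_bigr => i _ /=.
under eq_bigr do rewrite -mulrA.
rewrite -mulr_sumr kernel_form_sum mulrCA; congr (_ * _).
rewrite /xi /eta linear_sum.
under [X in ip X _]eq_bigr do rewrite linearZ.
rewrite ip_sum2 mulr_sumr; apply: eq_bigr => j _.
by rewrite mulr_sumr; apply: eq_bigr => l _; rewrite chiE mulrCA.
Qed.

Lemma algebraic_bound (y : 'I_k + 'I_k -> K) : algebraic tau y ->
  2 * \sum_a complex.Re (ip (\sum_b subset_map (v a b) (y (inl b))) (y (inr a))) <=
  m * (\sum_b rnorm (y (inl b)) ^+ 2 + \sum_a rnorm (y (inr a)) ^+ 2).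
Proof.
move=> [I [X [c yE]]].
pose beta i := complex.Re (\sum_a \sum_b
  l1coord (v a b) i * ip (subset_tensor i (y (inl b))) (y (inr a))).
have -> : \sum_a complex.Re (ip (\sum_b subset_map (v a b) (y (inl b))) (y (inr a))) =
    \sum_i beta i.
  rewrite -!Re_sum; congr complex.Re.
  rewrite [RHS]exchange_big; apply: eq_bigr => a _.
  rewrite [RHS]exchange_big ip_suml; apply: eq_bigr => b _.
  rewrite subset_mapE ip_suml; apply: eq_bigr => i _.
  by rewrite ipZl.
have rho : (fun N => N%:R / N.+1%:R : R) @ \oo --> (1 : R).
  have -> : (fun N => N%:R / N.+1%:R : R) = (fun N => 1 - harmonic N).
    apply/funext => N; rewrite /harmonic/= -natr1; field.
    by rewrite natr1 pnatr_eq0.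
  by rewrite -{2}[1]subr0; apply: cvgB; [exact: cvg_cst|exact: cvg_harmonic].
apply: (lim_le (u := fun N => 2 * \sum_i (N%:R / N.+1%:R) ^+ #|J i| * beta i)); last first.
  move=> N; have := fejer_bound N X (fun b => c (inl b)) (fun a => c (inr a)).
  rewrite /=; under eq_bigr do under eq_bigr do under eq_bigr do rewrite -!yE.
  by under [X in _ <= m * (X + _)]eq_bigr do rewrite -yE;
     under [X in _ <= m * (_ + X)]eq_bigr do rewrite -yE.
apply: cvgMr; apply: cvg_fin_sum => i.
rewrite -[X in _ --> X]mul1r; apply: cvgMl.
have := cvg_comp _ _ rho (@exprn_continuous R #|J i| 1).
by rewrite expr1n.
Qed.

(** Both sides are continuous in [y]. *)
Lemma dense_bound (y : 'I_k + 'I_k -> K) :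
  2 * \sum_a complex.Re (ip (\sum_b subset_map (v a b) (y (inl b))) (y (inr a))) <=
  m * (\sum_b rnorm (y (inl b)) ^+ 2 + \sum_a rnorm (y (inr a)) ^+ 2).
Proof.
have [u [ua uy]] := algebraic_dense tauP y.
rewrite -subr_le0.
apply: (lim_le (u := fun N => 2 * \sum_a complex.Re (ip (\sum_b
    subset_map (v a b) (u N (inl b))) (u N (inr a))) -
  m * (\sum_b rnorm (u N (inl b)) ^+ 2 + \sum_a rnorm (u N (inr a)) ^+ 2))); last first.
  by move=> N; rewrite subr_le0; exact: algebraic_bound.
have sq q : (fun N => rnorm (u N q) ^+ 2) @ \oo --> rnorm (y q) ^+ 2.
  by have h := cvg_rnorm (uy q); exact: (cvgM h h).
apply: cvgB; apply: cvgMr.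
  apply: cvg_fin_sum => a; apply: cvg_Re_ip; last exact: uy.
  apply: cvg_fin_sum => b; apply: continuous_cvg (uy _).
  exact: bop_continuous.
by apply: cvgD; apply: cvg_fin_sum => b; exact: sq.
Qed.

(** Pair [A x] with [A x / m]. *)
Lemma operator_bound (x : 'cV[K]_k) : 0 < m ->
  l2norm (\col_a \sum_b map_mx subset_map v a b (x b 0)) <= m * l2norm x.
Proof.
move=> m0; rewrite -(ler_pXn2r (n := 2))// ?nnegrE ?l2norm_ge0 ?mulr_ge0 ?l2norm_ge0 ?(ltW m0)//.
rewrite exprMn !sqr_l2norm.
pose w a := \sum_b subset_map (v a b) (x b 0).
under eq_bigr => a _.
  rewrite mxE; under eq_bigr do rewrite mxE.
  rewrite -/(w a); over.
have := dense_bound (fun q => match q with inl b => x b 0 | inr a => m^-1%:C *: w a end).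
under [X in 2 * X]eq_bigr => a _.
  rewrite /= -/(w a) ipZr conjc_real Re_mulR ipxx /=; over.
under [X in _ + X]eq_bigr => a _.
  rewrite /= rnormZ rnormR ger0_norm ?invr_ge0 1?ltW// exprMn; over.
rewrite -!mulr_sumr; set S := \sum_(a < k) rnorm (w a) ^+ 2.
set Y := \sum_(a < k) _; move=> h.
rewrite -(ler_pM2l (x := m^-1)) ?invr_gt0//.
have e1 : m^-1 * (m ^+ 2 * Y) = m * Y by field; rewrite gt_eqF.
have e2 : m * (Y + m^-1 ^+ 2 * S) = m * Y + m^-1 * S by field; rewrite gt_eqF.
by rewrite e1; move: h; rewrite e2; lra.
Qed.

End UpperBound.
End SubsetTensor.

(** * Norms of weighted sums of commuting tensors *)

Section L1Space.
Variables (R : realType) (n : nat).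

Lemma rnorm_l1 (a : l1 R n) : rnorm a = \sum_i rnorm (l1coord a i).
Proof. by rewrite {1}/rnorm -[`|a|]/(l1norm a) /l1norm Re_sum. Qed.

Lemma dual_ballP (f : {scalar l1 R n}) :
  dual_ball f <-> forall a, rnorm (f a) <= rnorm a.
Proof.
rewrite /dual_ball/=.
have fZ (t : R) (a : l1 R n) : 0 <= t -> rnorm (f (t%:C *: a)) = t * rnorm (f a).
  by move=> t0; rewrite linearZ rnormM rnormR ger0_norm.
rewrite (opnorm_leP fZ ler01).
by split=> h a; have := h a; rewrite mul1r.
Qed.

Lemma l1_scalarE (f : {scalar l1 R n}) : dual_ball f ->
  exists w : 'I_n -> R[i], (forall i, rnorm (w i) <= 1) /\
    forall a, f a = \sum_i l1coord a i * w i.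
Proof.
move=> /dual_ballP f1; pose e i : l1 R n := delta_mx 0 i.
exists (fun i => f (e i)); split=> [i|a].
  apply: le_trans (f1 _) _; rewrite rnorm_l1 (bigD1 i)//= /l1coord mxE !eqxx rnorm1.
  by rewrite big1 ?addr0// => j ji; rewrite mxE (negPf ji) andbF rnorm0.
have {1}-> : a = \sum_i l1coord a i *: e i by exact: row_sum_delta.
by rewrite linear_sum; apply: eq_bigr => i _; rewrite linearZ.
Qed.

Lemma l1_scalar_exists (w : 'I_n -> R[i]) : (forall i, rnorm (w i) <= 1) ->
  exists2 f : {scalar l1 R n}, dual_ball f &
    forall a, f a = \sum_i l1coord a i * w i.
Proof.
move=> w1; pose g (a : l1 R n) : R[i] := \sum_i l1coord a i * w i.
have gl : scalar g.
  move=> t a b; rewrite /g mulr_sumr -big_split; apply: eq_bigr => i _ /=.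
  by rewrite /l1coord !mxE mulrDl mulrA.
pose f : {scalar l1 R n} := HB.pack g (GRing.isLinear.Build R[i] (l1 R n) R[i] *%R g gl).
exists f => //; apply/dual_ballP => a; rewrite rnorm_l1.
apply: le_trans (ler_rnorm_sum _ _ _) _; apply: ler_sum => i _.
by rewrite rnormM ler_piMr ?rnorm_ge0.
Qed.

End L1Space.

Section CompleteIsometry.
Variables (R : realType) (n : nat) (H : 'I_n -> hilbertType R) (K : hilbertType R).
Variables (tau : (forall i, H i) -> K) (tauP : hilbert_tensor tau).
Variables (T : forall i, bop (H i)).
Hypothesis Tc : forall i x, rnorm (T i x) <= rnorm x.
Hypothesis Ts : forall i z, rnorm z = 1 -> spectrum (T i) z.
Variable J : 'I_n -> 'I_n -> bool.
Hypothesis J_onto : forall w : 'I_n -> R[i], (forall i, rnorm (w i) = 1) ->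
  exists2 z : 'I_n -> R[i], (forall j, rnorm (z j) = 1) &
    forall i, \prod_j (if J i j then z j else 1) = w i.

Local Notation S := (subset_tensor tau T J).
Local Notation phi := (subset_map tau T J).

(** Choose [w] with [alpha i * w i = |alpha i|], then [z] with [z^J = w], and for
    [x j] a unit vector with [<T j (x j), x j>] close to [z j]. *)
Lemma weights_approximated (alpha : 'I_n -> R[i]) (e : R) : 0 < e ->
  exists2 x, rnorm (tau x) = 1 &
    \sum_i rnorm (alpha i) - e <= rnorm (\sum_i alpha i * ip (S i (tau x)) (tau x)).
Proof.
move=> e0.
have /choice[w wP] i : exists w, rnorm w = 1 /\ alpha i * w = (rnorm (alpha i))%:C.
  by have [w w1 wE] := phase_exists (alpha i); exists w.
have [z z1 zE] := J_onto (fun i => (wP i).1).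
pose A := \sum_i rnorm (alpha i).
have A0 : 0 <= A by apply: sumr_ge0 => i _; exact: rnorm_ge0.
(* Each of the [n] factors adds an error below [delta], and the weights add up
   to [A]; the added units keep the denominator positive. *)
pose delta := e / ((A + 1) * n.+1%:R).
have delta0 : 0 < delta by rewrite divr_gt0// mulr_gt0// ltr_wpDl.
have X j := cid2 (numerical_range_dense (@Tc j) (z1 j) (Ts (z1 j)) delta0).
pose x j := s2val (X j).
have x1 j : rnorm (x j) = 1 := s2valP (X j).
have xz j : rnorm (ip (T j (x j)) (x j) - z j) < delta := s2valP' (X j).
have tau1 : rnorm (tau x) = 1.
  apply/eqP; rewrite -(@pexpr_eq1 _ _ 2) ?rnorm_ge0//; apply/eqP/complexI.
  rewrite -ipxx (ip_tau tauP) big1// => i _; rewrite ipxx x1 expr1n.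
  by [].
exists x => //.
have SE i : rnorm (ip (S i (tau x)) (tau x) - w i) <= delta * n%:R.
  rewrite (ip_subset_tensor tauP Tc) -zE.
  apply: le_trans (prod_dist_le _ _ _) _ => [j|j|].
  - case: ifP => _; last by rewrite ipxx x1 expr1n rnorm1.
    apply: le_trans (ip_le _ _) _; rewrite x1 mulr1.
    by apply: le_trans (Tc _) _; rewrite x1.
  - by case: ifP => _; rewrite ?z1 ?rnorm1.
  apply: le_trans (_ : \sum_(j < n) delta <= _); last first.
    by rewrite sumr_const card_ord mulr_natr.
  apply: ler_sum => j _; case: ifP => _; first exact/ltW/xz.
  by rewrite ipxx x1 expr1n subrr rnorm0 ltW.
have AE : \sum_i alpha i * w i = A%:C.
  by rewrite rmorph_sum; apply: eq_bigr => i _; exact: (wP i).2.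
rewrite lerBlDr -/A -[A]ger0_norm// -rnormR -AE.
set p := \sum_(i < n) _; set q := \sum_(i < n) _.
rewrite -[p](subrK q) addrC; apply: le_trans (ler_rnormD _ _) _; rewrite lerD2l.
rewrite rdistrC /p /q -sumrB; apply: le_trans (ler_rnorm_sum _ _ _) _.
apply: le_trans (_ : \sum_i rnorm (alpha i) * (delta * n%:R) <= _).
  apply: ler_sum => i _; rewrite -mulrBr rnormM ler_wpM2l ?rnorm_ge0//.
rewrite -mulr_suml -/A /delta.
have -> : A * (e / ((A + 1) * n.+1%:R) * n%:R) = e * ((A * n%:R) / ((A + 1) * n.+1%:R)).
  by rewrite !mulrA (mulrC A e) mulrAC.
rewrite ler_piMr ?(ltW e0)// ler_pdivrMr ?mulr_gt0 ?ltr_wpDl//.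
by rewrite mul1r ler_pM// ?lerDl// ler_nat.
Qed.

Lemma subset_map_isometry : linear_isometry phi.
Proof.
split=> [|a]; first exact: subset_map_linear.
apply/eqP; rewrite eq_le; apply/andP; split.
  apply/(bop_opnorm_leP _ (rnorm_ge0 _)) => y.
  rewrite subset_mapE rnorm_l1 mulr_suml.
  apply: le_trans (ler_rnorm_sum _ _ _) _; apply: ler_sum => i _.
  by rewrite rnormZ ler_wpM2l ?rnorm_ge0// subset_tensor_contr.
apply/lee_addgt0Pr => e e0.
have [x x1 xe] := weights_approximated (l1coord a) e0.
apply: le_trans (_ : ((rnorm (phi a (tau x)))%:E + e%:E <= _)%E); last first.
  by rewrite leeD2r//; apply: ereal_sup_ubound; exists (tau x) => //=; rewrite x1.
rewrite -EFinD lee_fin -lerBlDr rnorm_l1; apply: le_trans xe _.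
have -> : \sum_i l1coord a i * ip (S i (tau x)) (tau x) = ip (phi a (tau x)) (tau x).
  by rewrite subset_mapE ip_suml; apply: eq_bigr => i _; rewrite ipZl.
by apply: le_trans (ip_le _ _) _; rewrite x1 mulr1.
Qed.

(** Every point [z] of the torus gives the functional [a |-> \sum_i a_i z^J_i] of
    norm at most one, so a bound on MIN is the hypothesis of [operator_bound]. *)
Lemma induced_le_MIN k (v : 'M[l1 R n]_k) : (bopmx_norm (map_mx phi v) <= MIN (l1 R n) k v)%E.
Proof.
apply: ereal_le_ge0.
  have [|f fb _] := @l1_scalar_exists R n (fun=> 0); first by move=> _; rewrite rnorm0 ler01.
  apply: le_trans (mx_opnorm_ge0 (map_mx f v)) _.
  by apply: ereal_sup_ubound; exists f.
move=> m m0 hm; apply/(bopmx_norm_leP _ (ltW m0)) => y.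
apply: (operator_bound tauP Tc) => // z z1 c d.
have [i|f fb fE] := @l1_scalar_exists R n (fun i => \prod_j (if J i j then z j else 1)).
  by rewrite rnorm_prod big1// => j _; case: ifP; rewrite ?rnorm1.
have /(mx_opnorm_leP _ (ltW m0)) fm : (mx_opnorm (map_mx f v) <= m%:E)%E.
  by apply: le_trans hm; apply: ereal_sup_ubound; exists f.
have l2E (g : 'I_k -> R[i]) : l2norm (\col_a g a) = Num.sqrt (\sum_a rnorm (g a) ^+ 2).
  by rewrite /l2norm; congr Num.sqrt; apply: eq_bigr => a _; rewrite mxE.
have sqE (g : 'I_k -> R[i]) : \sum_a rnorm (g a) ^+ 2 = l2norm (\col_a g a) ^+ 2.
  by rewrite sqr_l2norm; apply: eq_bigr => a _; rewrite mxE.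
pose Bc a := (map_mx f v *m \col_b c b) a 0.
have -> : \sum_a (\sum_b (\sum_i l1coord (v a b) i *
    \prod_j (if J i j then z j else 1)) * c b) * conjc (d a) =
    \sum_a Bc a * conjc (d a).
  apply: eq_bigr => a _; congr (_ * _); rewrite /Bc mxE; apply: eq_bigr => b _.
  by rewrite !mxE fE.
have h1 : complex.Re (\sum_a Bc a * conjc (d a)) <=
    l2norm (map_mx f v *m \col_b c b) * l2norm (\col_a d a).
  apply: le_trans (Re_le_rnorm _) _; apply: le_trans (ler_rnorm_sum _ _ _) _.
  under eq_bigr do rewrite rnormM rnormJ.
  by rewrite l2E; exact: sum_mul_le.
have h2 := fm (\col_b c b).
rewrite !sqE.
have c0 := l2norm_ge0 (\col_b c b); have d0 := l2norm_ge0 (\col_a d a).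
have h3 := ler_wpM2r d0 h2.
move: (l2norm (\col_b c b)) (l2norm (\col_a d a)) c0 d0 h1 h3 => C D C0 D0 h1 h3.
have h4 := le_trans h1 h3.
have h5 : 0 <= m * (C - D) ^+ 2 by rewrite mulr_ge0 ?sqr_ge0// ltW.
move: h4 h5; set X := complex.Re _ => h4 h5.
have -> : m * (C ^+ 2 + D ^+ 2) = m * (C - D) ^+ 2 + 2 * (m * C * D) by ring.
lra.
Qed.

(** For a functional with weights [w] put [d = \sum_i w_i A_i c] and
    [alpha i = <A_i c, d>]; then [|d|^2 = \sum_i w_i (alpha i)], and the sum of
    the [|alpha i|] is controlled on the vectors [c (x) tau x], [d (x) tau x]. *)
Lemma MIN_le_induced k (v : 'M[l1 R n]_k) : (MIN (l1 R n) k v <= bopmx_norm (map_mx phi v))%E.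
Proof.
apply: ereal_le_ge0; first exact: bopmx_norm_ge0.
move=> m m0 /(bopmx_norm_leP _ (ltW m0)) hm.
apply: ge_ereal_sup => _ [f fb <-].
have [w [w1 fE]] := l1_scalarE fb.
apply/(mx_opnorm_leP _ (ltW m0)) => c.
set d := map_mx f v *m c.
pose alpha i := \sum_a \sum_b l1coord (v a b) i * c b 0 * conjc (d a 0).
have dE : (l2norm d ^+ 2)%:C = \sum_i alpha i * w i.
  rewrite sqr_l2norm rmorph_sum/=.
  transitivity (\sum_a d a 0 * conjc (d a 0)).
    by apply: eq_bigr => a _; rewrite mulcJ.
  under [RHS]eq_bigr do rewrite mulr_suml.
  rewrite [RHS]exchange_big; apply: eq_bigr => a _.
  under [RHS]eq_bigr do rewrite mulr_suml.
  rewrite [RHS]exchange_big {1}/d mxE mulr_suml; apply: eq_bigr => b _.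
  rewrite mxE fE !mulr_suml; apply: eq_bigr => i _.
  by rewrite -!mulrA; congr (_ * _); rewrite mulrC -mulrA.
have dle : l2norm d ^+ 2 <= \sum_i rnorm (alpha i).
  rewrite -[leLHS]ger0_norm ?sqr_ge0// -rnormR dE.
  apply: le_trans (ler_rnorm_sum _ _ _) _; apply: ler_sum => i _.
  by rewrite rnormM ler_piMr ?rnorm_ge0.
have alpha_le : \sum_i rnorm (alpha i) <= m * l2norm c * l2norm d.
  apply/ler_addgt0Pr => e e0; rewrite -lerBlDr.
  have [x x1 xe] := weights_approximated alpha e0.
  apply: le_trans xe _.
  pose y : 'cV[K]_k := \col_b (c b 0 *: tau x).
  have -> : \sum_i alpha i * ip (S i (tau x)) (tau x) =
      \sum_a ip (\sum_b map_mx phi v a b (y b 0)) (d a 0 *: tau x).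
    under eq_bigr do rewrite mulr_suml.
    rewrite exchange_big; apply: eq_bigr => a _.
    under eq_bigr do rewrite mulr_suml.
    rewrite exchange_big ip_suml; apply: eq_bigr => b _.
    rewrite !mxE subset_mapE ip_suml; apply: eq_bigr => i _.
    by rewrite linearZ !ipZl ipZr; ring.
  apply: le_trans (ler_rnorm_sum _ _ _) _.
  have yc : l2norm y = l2norm c.
    rewrite /l2norm; congr Num.sqrt; apply: eq_bigr => b _.
    by rewrite mxE rnormZ x1 mulr1.
  rewrite -yc; apply: le_trans (_ : l2norm (\col_a \sum_b map_mx phi v a b (y b 0)) *
    l2norm d <= _); last by rewrite ler_wpM2r ?l2norm_ge0.
  rewrite /l2norm; under [X in Num.sqrt X * _]eq_bigr do rewrite mxE.
  apply: le_trans (sum_mul_le _ _); apply: ler_sum => a _.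
  by apply: le_trans (ip_le _ _) _; rewrite rnormZ x1 mulr1.
have [->|d0] := eqVneq (l2norm d) 0; first by rewrite mulr_ge0 ?l2norm_ge0 ?(ltW m0).
have d1 : 0 < l2norm d by rewrite lt_def d0 l2norm_ge0.
by rewrite -(ler_pM2r d1) -expr2 (le_trans dle).
Qed.

Lemma subset_map_MIN : completely_isometric (induced_norms phi) (MIN (l1 R n)).
Proof.
exists idfun; first by exists idfun.
move=> k _ v; have -> : map_mx idfun v = v by apply/matrixP => a b; rewrite mxE.
by apply: le_anti; rewrite MIN_le_induced induced_le_MIN.
Qed.

End CompleteIsometry.

Lemma singleton_onto (R : realType) (n : nat) (w : 'I_n -> R[i]) :
  (forall i, rnorm (w i) = 1) ->
  exists2 z : 'I_n -> R[i], (forall j, rnorm (z j) = 1) &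
    forall i, \prod_j (if j == i then z j else 1) = w i.
Proof.
by move=> w1; exists w => // i; rewrite -big_mkcond big_pred1_eq.
Qed.

(** Take [z 0 = w 0] and [z j = w j / w (j-1)]. *)
Lemma segment_onto (R : realType) (n : nat) (w : 'I_n -> R[i]) :
  (forall i, rnorm (w i) = 1) ->
  exists2 z : 'I_n -> R[i], (forall j, rnorm (z j) = 1) &
    forall i : 'I_n, \prod_(j < n) (if (j <= i)%N then z j else 1) = w i.
Proof.
move=> w1; pose u k := if insub k is Some i then w i else 1.
have u1 k : rnorm (u k) = 1 by rewrite /u; case: insubP => // _; exact: rnorm1.
have u0 k : u k != 0 by rewrite -rnorm_gt0 u1.
pose z k := if k is k'.+1 then u k'.+1 / u k' else u 0%N.
have z1 k : rnorm (z k) = 1.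
  case: k => [|k]; rewrite /z ?u1//.
  by apply: (@mulIf _ (rnorm (u k))); rewrite -?rnormM ?mulfVK ?u1 ?mul1r// oner_eq0.
exists (fun j => z j) => // i.
rewrite -big_mkcond -(big_ord_widen n z (ltn_ord i)).
have uE : forall k, \prod_(j < k.+1) z j = u k.
  elim=> [|k IH]; first by rewrite big_ord_recl big_ord0 mulr1.
  by rewrite big_ord_recr IH /= mulrC divfK.
by rewrite uE /u valK.
Qed.

Local Close Scope complex_scope.

Theorem mainTheorem4 (R : realType) (n : nat) (n_gt0 : (0 < n)%N)
    (H : 'I_n -> hilbertType R) (K : hilbertType R)
    (tau : (forall i, H i) -> K) (tauP : hilbert_tensor tau)
    (T : forall i, bop (H i))
    (T_contraction : forall i, contractive (T i))
    (T_spectrum : forall i, [set z : R[i] | `|z| = 1] `<=` spectrum (T i)) :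
  [/\ linear_isometry (f_map tau T),
      linear_isometry (g_map tau T),
      completely_isometric (induced_norms (f_map tau T)) (MIN (l1 R n)) &
      completely_isometric (induced_norms (g_map tau T)) (MIN (l1 R n))].
Proof.
have Tc i x : rnorm (T i x) <= rnorm x.
  exact: (contractiveP (T i)).1 (T_contraction i) x.
have Ts i z : rnorm z = 1 -> spectrum (T i) z.
  by move=> z1; apply: T_spectrum; exact/unit_normP.
split.
- exact: (subset_map_isometry tauP Tc Ts (@singleton_onto R n)).
- exact: (subset_map_isometry tauP Tc Ts (@segment_onto R n)).
- exact: (subset_map_MIN tauP Tc Ts (@singleton_onto R n)).
- exact: (subset_map_MIN tauP Tc Ts (@segment_onto R n)).
Qed.
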